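(* Let $\widehat u=(\widehat u_-,\widehat u_+)\in\mathbb{C}^2$ satisfy $\widehat u_-\neq 0$ and $\widehat u_+\neq 0$. Let $\mathcal J:=\{0,\pm\mathrm{L},\pm\mathrm{R},\pm\mathrm{X},\pm\mathrm{Y}\}$ (an index set of nine symbols). There exist a constant $\ell=\ell(\widehat u)>0$ and a family $\{E^{(j)}_{\widehat u}\}_{j\in\mathcal J}$ of nine continuous functions $$E^{(j)}_{\widehat u}:\{\lambda\in\mathbb{C}:0<|\lambda|<\ell\}\to\mathbb{C}^2,\qquad j\in\mathcal J,$$ with pairwise distinct values, that have the following properties. (i) If in system (S) the injected field is of the form $u=\lambda\widehat u$ with $0<|\lambda|<\ell$, then a triple $(E,N,n)\in\mathbb{C}^2\times\mathbb{R}\times\mathbb{R}$ is an equilibrium point of (S) if and only if $$E=E^{(j)}_{\widehat u}(\lambda)\ \text{for some } j\in\mathcal J,\quad\text{and}\quad (N,n)=y(|E_-|,|E_+|).$$ (ii) With $\theta:=-\arg(1+i\alpha)$, the functions $E^{(j)}_{\widehat u}$ have the following asymptotics as $\lambda\to 0$: $$E^{(0)}_{\widehat u}(\lambda)=e^{i\theta}\frac{\lambda}{|\lambda|}\Big(|\lambda|\,\widehat w^{(0)}+o(\lambda)\Big),$$ $$E^{(\pm\mathrm L)}_{\widehat u}(\lambda)=e^{i\theta}\frac{\lambda}{|\lambda|}\Big(\pm\sqrt{\tfrac{\delta(\mu-1)}{1+\delta}}\begin{bmatrix}\widehat u_-/|\widehat u_-|\\0\end{bmatrix}+|\lambda|\,\widehat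 w^{(\mathrm L)}+o(\lambda)\Big),$$ $$E^{(\pm\mathrm R)}_{\widehat u}(\lambda)=e^{i\theta}\frac{\lambda}{|\lambda|}\Big(\pm\sqrt{\tfrac{\delta(\mu-1)}{1+\delta}}\begin{bmatrix}0\\ \widehat u_+/|\widehat u_+|\end{bmatrix}+|\lambda|\,\widehat w^{(\mathrm R)}+o(\lambda)\Big),$$ $$E^{(\pm\mathrm X)}_{\widehat u}(\lambda)=e^{i\theta}\frac{\lambda}{|\lambda|}\Big(\pm\sqrt{\tfrac{\mu-1}{2}}\begin{bmatrix}\widehat u_-/|\widehat u_-|\\ \widehat u_+/|\widehat u_+|\end{bmatrix}+|\lambda|\,\widehat w^{(\mathrm X)}+o(\lambda)\Big),$$ $$E^{(\pm\mathrm Y)}_{\widehat u}(\lambda)=e^{i\theta}\frac{\lambda}{|\lambda|}\Big(\pm\sqrt{\tfrac{\mu-1}{2}}\begin{bmatrix}\widehat u_-/|\widehat u_-|\\ -\widehat u_+/|\widehat u_+|\end{bmatrix}+|\lambda|\,\widehat w^{(\mathrm Y)}+o(\lambda)\Big),$$ where $$\widehat w^{(0)}:=\frac{-1}{|1+i\alpha|(\mu-1)}\widehat u,$$ $$\widehat w^{(\mathrm L)}:=\frac{1}{2|1+i\alpha|(\mu-1)}\begin{bmatrix}\mu\,\widehat u_-\\ -(1+\delta)\,\widehat u_+\end{bmatrix},\qquad \widehat w^{(\mathrm R)}:=\frac{1}{2|1+i\alpha|(\mu-1)}\begin{bmatrix}-(1+\delta)\,\widehat u_-\\ \mu\,\widehat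 u_+\end{bmatrix},$$ $$\widehat w^{(\mathrm X)}:=\frac{1}{4|1+i\alpha|(\mu-1)}\begin{bmatrix}\big(2\mu+\delta-1+(1-\delta)|\widehat u_+|/|\widehat u_-|\big)\widehat u_-\\ \big((1-\delta)|\widehat u_-|/|\widehat u_+|+2\mu+\delta-1\big)\widehat u_+\end{bmatrix},$$ $$\widehat w^{(\mathrm Y)}:=\frac{1}{4|1+i\alpha|(\mu-1)}\begin{bmatrix}\big(2\mu+\delta-1+(\delta-1)|\widehat u_+|/|\widehat u_-|\big)\widehat u_-\\ \big((\delta-1)|\widehat u_-|/|\widehat u_+|+2\mu+\delta-1\big)\widehat u_+\end{bmatrix}.$$ (iii) Furthermore, if $|\widehat u_-|=|\widehat u_+|$ and $j\in\{0,+\mathrm X,-\mathrm X\}$, then for every $\lambda$ with $0<|\lambda|<\ell$ it holds that $E^{(j)}_{\widehat u}(\lambda)=\rho^{(j)}(\lambda)\,\widehat u$ for some $\rho^{(j)}(\lambda)\in\mathbb{C}$.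
   Context: Fixed real parameters: $\kappa,\gamma,\delta\in(0,\infty)$, $\alpha\in\mathbb{R}$, $\mu>1$ (all constants may depend on them). For $z=(z_1,z_2)\in\mathbb{C}^2$ define $$X(z):=\begin{bmatrix}1-(z_1-z_2)&0\\0&1-(z_1+z_2)\end{bmatrix},\qquad Y(z):=\begin{bmatrix}1+|z|^2&|z_2|^2-|z_1|^2\\ |z_2|^2-|z_1|^2&\delta+|z|^2\end{bmatrix},$$ where $|z|^2=|z_1|^2+|z_2|^2$. For a constant $u=(u_-,u_+)\in\mathbb{C}^2$ (the injected field), system (S) is the following system of ODEs for $E(t)=(E_-(t),E_+(t))\in\mathbb{C}^2$ and $N(t),n(t)\in\mathbb{R}$: $$\frac{d}{dt}E=-\kappa\big((1+i\alpha)X(N,n)E-u\big),\qquad \frac{d}{dt}\begin{bmatrix}N\\ n\end{bmatrix}=-\gamma\Big(Y(E)\begin{bmatrix}N\\ n\end{bmatrix}-\begin{bmatrix}\mu\\0\end{bmatrix}\Big).\tag{S}$$ An equilibrium point of (S) is a triple $(E,N,n)\in\mathbb{C}^2\times\mathbb{R}\times\mathbb{R}$ at which both right-hand sides vanish. The function $y:\mathbb{R}^2\to\mathbb{R}^2$ is $$y(x):=Y(x)^{-1}\begin{bmatrix}\mu\\0\end{bmatrix}=\frac{\mu}{\det Y(x)}\begin{bmatrix}\delta+|x|^2\\ x_1^2-x_2^2\end{bmatrix},\qquad \det Y(x)=\delta+(1+\delta)|x|^2+4x_1^2x_2^2>0.$$ The notation $o(\lambda)$ stands for a $\mathbb{C}^2$-valued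 function $g(\lambda)$ with $|g(\lambda)|/|\lambda|\to 0$ as $\lambda\to 0$. *)

(* Defs.v *)
From Stdlib Require Import Reals Lra.
From Coquelicot Require Import Coquelicot.

Open Scope R_scope.

(** Vectors are pairs, with the "-" component first for fields in C^2; a matrix
    acts on a pair viewed as a one-column matrix. *)

Definition matvec {K : Ring} (M : @matrix K 2 2) (v : K * K) : K * K :=
  let w := Mmult M ([[fst v], [snd v]] : @matrix K 2 1) in
  (coeff_mat zero w 0 0, coeff_mat zero w 1 0).

Lemma matvecE {K : Ring} (a b c d x y : K) :
  matvec ([[a, b], [c, d]] : @matrix K 2 2) (x, y) =
  (plus (mult a x) (mult b y), plus (mult c x) (mult d y)).
Proof.
unfold matvec, Mmult; rewrite !coeff_mat_bij by auto with arith.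
simpl; rewrite !sum_Sn, !sum_O; reflexivity.
Qed.

Definition det2 (M : @matrix R 2 2) : R :=
  coeff_mat 0 M 0 0 * coeff_mat 0 M 1 1 - coeff_mat 0 M 0 1 * coeff_mat 0 M 1 0.

(** Adjugate formula: the inverse of [M] when [det2 M <> 0]. *)
Definition inv2 (M : @matrix R 2 2) : @matrix R 2 2 :=
  [[  coeff_mat 0 M 1 1 / det2 M, - coeff_mat 0 M 0 1 / det2 M],
   [- coeff_mat 0 M 1 0 / det2 M,   coeff_mat 0 M 0 0 / det2 M]].

(** The norm that Coquelicot puts on a product is the Euclidean one. *)
Definition norm2 (z : C * C) : R :=
  @norm C_AbsRing
    (prod_NormedModule C_AbsRing C_NormedModule C_NormedModule) z.

Lemma norm2E (z : C * C) :
  norm2 z = sqrt (Cmod (fst z) ^ 2 + Cmod (snd z) ^ 2).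
Proof. reflexivity. Qed.

Lemma norm2_sqr (z : C * C) :
  norm2 z ^ 2 = Cmod (fst z) ^ 2 + Cmod (snd z) ^ 2.
Proof. rewrite norm2E; apply pow2_sqrt; nra. Qed.

(** Principal argument, with values in (-PI, PI]. *)
Definition Carg (z : C) : R :=
  if Rle_dec 0 (Im z) then acos (Re z / Cmod z) else - acos (Re z / Cmod z).

Definition cis (t : R) : C := (cos t, sin t).

Lemma Carg_spec (z : C) :
  z <> RtoC 0 ->
  z = Cmult (RtoC (Cmod z)) (cis (Carg z)) /\ - PI < Carg z <= PI.
Proof.
intros Hz.
pose proof (proj1 (Cmod_gt_0 z) Hz) as Hr.
pose proof (re_le_Cmod z) as Hre.
pose proof (Cmod2_alt z) as Hsq.
set (c := Re z / Cmod z).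
assert (Hcz : Cmod z * c = Re z) by (unfold c; field; lra).
apply Rabs_le_between in Hre.
assert (Hc : -1 <= c <= 1) by (split; nra).
assert (Hs : Cmod z * sqrt (1 - c²) = Rabs (Im z)).
{ replace (Cmod z) with (sqrt (Cmod z ^ 2)) by (apply sqrt_pow2; lra).
  rewrite <- sqrt_mult_alt by nra.
  rewrite <- (sqrt_Rsqr_abs (Im z)).
  f_equal; unfold Rsqr; nra. }
pose proof (acos_bound c) as Hb.
pose proof PI_RGT_0 as HPI.
unfold Carg; fold c.
destruct (Rle_dec 0 (Im z)) as [Hi | Hi]; split.
- destruct z as [a b]; unfold cis, Cmult, RtoC; simpl fst in *; simpl snd in *.
  rewrite cos_acos, sin_acos by exact Hc.
  unfold Re, Im in *; simpl fst in *; simpl snd in *.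
  rewrite Rabs_pos_eq in Hs by exact Hi.
  f_equal; lra.
- lra.
- destruct z as [a b]; unfold cis, Cmult, RtoC; simpl fst in *; simpl snd in *.
  rewrite cos_neg, sin_neg, cos_acos, sin_acos by exact Hc.
  unfold Re, Im in *; simpl fst in *; simpl snd in *.
  rewrite Rabs_left in Hs by lra.
  f_equal; lra.
- assert (c <> -1).
  { intros Hc1; rewrite Hc1 in Hs.
    replace (1 - (-1)²) with 0 in Hs by (unfold Rsqr; ring).
    rewrite sqrt_0, Rabs_left in Hs by lra; lra. }
  assert (acos c <> PI).
  { intros Ha; apply (f_equal cos) in Ha.
    rewrite cos_acos, cos_PI in Ha by exact Hc; lra. }
  lra.
Qed.

Definition X (z : C * C) : @matrix C_Ring 2 2 :=
  [[(1 - (fst z - snd z))%C, RtoC 0],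
   [RtoC 0, (1 - (fst z + snd z))%C]].

Definition Y (delta : R) (z : C * C) : @matrix R_Ring 2 2 :=
  [[1 + norm2 z ^ 2, Cmod (snd z) ^ 2 - Cmod (fst z) ^ 2],
   [Cmod (snd z) ^ 2 - Cmod (fst z) ^ 2, delta + norm2 z ^ 2]].

Definition rhs_E (kappa alpha : R) (u E : C * C) (N n : R) : C * C :=
  scal (RtoC (- kappa))
    (minus (scal (1 + Ci * alpha)%C (matvec (X (RtoC N, RtoC n)) E)) u).

Definition rhs_Nn (gamma delta mu : R) (E : C * C) (N n : R) : R * R :=
  scal (- gamma) (minus (matvec (Y delta E) (N, n)) (mu, 0)).

Definition is_equilibrium (kappa gamma delta alpha mu : R) (u : C * C)
    (E : C * C) (N n : R) : Prop :=
  rhs_E kappa alpha u E N n = (RtoC 0, RtoC 0) /\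
  rhs_Nn gamma delta mu E N n = (0, 0).

Definition y (delta mu : R) (x : R * R) : R * R :=
  matvec (inv2 (Y delta (RtoC (fst x), RtoC (snd x)))) (mu, 0).

Lemma Y_real (delta : R) (x : R * R) :
  Y delta (RtoC (fst x), RtoC (snd x)) =
  [[1 + (fst x ^ 2 + snd x ^ 2), snd x ^ 2 - fst x ^ 2],
   [snd x ^ 2 - fst x ^ 2, delta + (fst x ^ 2 + snd x ^ 2)]].
Proof.
destruct x as [x1 x2]; unfold Y; rewrite norm2_sqr; unfold fst, snd.
now rewrite !Cmod_R, !pow2_abs.
Qed.

Lemma det_Y (delta : R) (x : R * R) :
  det2 (Y delta (RtoC (fst x), RtoC (snd x))) =
  delta + (1 + delta) * (fst x ^ 2 + snd x ^ 2) + 4 * fst x ^ 2 * snd x ^ 2.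
Proof. rewrite Y_real; unfold det2, coeff_mat; simpl; ring. Qed.

Lemma det_Y_gt0 (delta : R) (x : R * R) :
  0 < delta -> 0 < det2 (Y delta (RtoC (fst x), RtoC (snd x))).
Proof.
intros Hd; rewrite det_Y.
pose proof (pow2_ge_0 (fst x)) as H1; pose proof (pow2_ge_0 (snd x)) as H2.
pose proof (Rmult_le_pos _ _ H1 H2); nra.
Qed.

Lemma yE (delta mu : R) (x : R * R) :
  0 < delta ->
  y delta mu x =
  scal (mu / det2 (Y delta (RtoC (fst x), RtoC (snd x))))
    (delta + (fst x ^ 2 + snd x ^ 2), fst x ^ 2 - snd x ^ 2).
Proof.
intros Hd; pose proof (det_Y_gt0 delta x Hd) as HD.
unfold y, inv2; set (D := det2 _) in *; rewrite matvecE, Y_real.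
unfold coeff_mat, scal; simpl; unfold prod_scal, scal; simpl.
unfold plus, mult; simpl; unfold mult; simpl.
f_equal; field; lra.
Qed.

Lemma Y_y (delta mu : R) (x : R * R) :
  0 < delta ->
  matvec (Y delta (RtoC (fst x), RtoC (snd x))) (y delta mu x) = (mu, 0).
Proof.
intros Hd; pose proof (det_Y_gt0 delta x Hd) as HD.
rewrite yE by exact Hd; rewrite det_Y in *; rewrite Y_real.
match goal with |- matvec _ (scal ?c (?a, ?b)) = _ =>
  change (scal c (a, b)) with (c * a, c * b) end.
rewrite matvecE; unfold plus, mult; simpl; simpl in HD.
f_equal; field; lra.
Qed.

Definition little_o (g : C -> C * C) : Prop :=
  filterlim (fun lambda : C => norm2 (g lambda) / Cmod lambda)
    (locally' (RtoC 0)) (locally 0).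

(** [JPos m] and [JNeg m] stand for the symbols +m and -m. *)
Inductive mode : Set := ModeL | ModeR | ModeX | ModeY.
Inductive index : Set := JZero | JPos (m : mode) | JNeg (m : mode).

Definition Csgn (z : C) : C := (z / Cmod z)%C.

Definition mode_vec (delta mu : R) (uh : C * C) (m : mode) : C * C :=
  let (um, up) := uh in
  match m with
  | ModeL => scal (RtoC (sqrt (delta * (mu - 1) / (1 + delta))))
               (Csgn um, RtoC 0)
  | ModeR => scal (RtoC (sqrt (delta * (mu - 1) / (1 + delta))))
               (RtoC 0, Csgn up)
  | ModeX => scal (RtoC (sqrt ((mu - 1) / 2))) (Csgn um, Csgn up)
  | ModeY => scal (RtoC (sqrt ((mu - 1) / 2))) (Csgn um, (- Csgn up)%C)
  end.

(** [order0] and [order1] are the coefficients of the expansion in powers of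
    |lambda|, once the phase [cis theta * lambda / |lambda|] is factored out. *)
Definition order0 (delta mu : R) (uh : C * C) (j : index) : C * C :=
  match j with
  | JZero => (RtoC 0, RtoC 0)
  | JPos m => mode_vec delta mu uh m
  | JNeg m => opp (mode_vec delta mu uh m)
  end.

Definition mode_w (delta alpha mu : R) (uh : C * C) (m : mode) : C * C :=
  let (um, up) := uh in
  let a := Cmod (1 + Ci * alpha) in
  match m with
  | ModeL => scal (RtoC (1 / (2 * a * (mu - 1))))
               ((mu * um)%C, (- (1 + delta) * up)%C)
  | ModeR => scal (RtoC (1 / (2 * a * (mu - 1))))
               ((- (1 + delta) * um)%C, (mu * up)%C)
  | ModeX => scal (RtoC (1 / (4 * a * (mu - 1))))
      ((RtoC (2 * mu + delta - 1 + (1 - delta) * (Cmod up / Cmod um)) * um)%C,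
       (RtoC ((1 - delta) * (Cmod um / Cmod up) + 2 * mu + delta - 1) * up)%C)
  | ModeY => scal (RtoC (1 / (4 * a * (mu - 1))))
      ((RtoC (2 * mu + delta - 1 + (delta - 1) * (Cmod up / Cmod um)) * um)%C,
       (RtoC ((delta - 1) * (Cmod um / Cmod up) + 2 * mu + delta - 1) * up)%C)
  end.

Definition order1 (delta alpha mu : R) (uh : C * C) (j : index) : C * C :=
  match j with
  | JZero => scal (RtoC (-1 / (Cmod (1 + Ci * alpha) * (mu - 1)))) uh
  | JPos m | JNeg m => mode_w delta alpha mu uh m
  end.

(* Main.v *)
Require Import Defs.
From Stdlib Require Import Reals Lra List Classical ClassicalEpsilon.
From Coquelicot Require Import Coquelicot.

Open Scope R_scope.

(** At an equilibrium the gain factors [1 - (N - n)] and [1 - (N + n)] are real, so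
    each component of [E] equals the corresponding component of
    [lambda uh / (1 + i alpha)] times a real number.  Writing
    [E = phase * (sgn(u_-) x1, sgn(u_+) x2)] with real [x1] and [x2], and inserting
    the equilibrium value of [(N, n)], which depends only on [x1^2] and [x2^2], turns
    the system into two real equations [F x = s p], where [s = |lambda|] and
    [p = (|u_-|, |u_+|) / |1 + i alpha|] ([equilibrium_balance]).  A complex phase
    and the carriers have disappeared, and [lambda] enters through [s] alone.

    For [s = 0] the equations factor: [F] vanishes exactly at the origin, at two
    points on each axis and at two points on each diagonal ([balance_zeros]).  At all
    nine the Jacobian of [F] is invertible ([regular_zero_of]), so the inverse
    function theorem continues each of them to a unique nearby solution for small
    [s], with velocity [J^-1 p]; these velocities are the coefficients of [|lambda|]
    in the asymptotics.  Moreover [F] is coercive ([balance_coercive]), so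
    by compactness no further solution of [F x = s p] appears for small [s]
    ([perturbed_zeros]).

    If [|u_-| = |u_+|], then [p] is symmetric, and exchanging the coordinates maps
    solutions to solutions.  By uniqueness the branches that start at a symmetric
    zero stay on the diagonal [x1 = x2], where [E] is a multiple of the injected field
    ([symmetric_branch], [diagonal_field]).

    The inverse function theorem in the plane is proved here directly, for functions
    that are strictly differentiable at one point ([inverse_function]).  Distances in
    the plane are measured in the maximum norm throughout. *)

(** * Compactness and contractions in the plane *)

Definition supdist (x x' : R * R) : R :=
  Rmax (Rabs (fst x - fst x')) (Rabs (snd x - snd x')).

Lemma supdist_le (x x' : R * R) (e : R) :
  supdist x x' <= e <-> Rabs (fst x - fst x') <= e /\ Rabs (snd x - snd x') <= e.
Proof.
unfold supdist; split.
- intros H; split; (eapply Rle_trans; [| exact H]); [apply Rmax_l | apply Rmax_r].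
- intros [H1 H2]; now apply Rmax_lub.
Qed.

Lemma fst_le_supdist (x x' : R * R) : Rabs (fst x - fst x') <= supdist x x'.
Proof. apply Rmax_l. Qed.

Lemma snd_le_supdist (x x' : R * R) : Rabs (snd x - snd x') <= supdist x x'.
Proof. apply Rmax_r. Qed.

Lemma supdist_ge0 (x x' : R * R) : 0 <= supdist x x'.
Proof. eapply Rle_trans; [apply Rabs_pos | apply fst_le_supdist]. Qed.

Lemma supdist_sym (x x' : R * R) : supdist x x' = supdist x' x.
Proof. unfold supdist; now rewrite (Rabs_minus_sym (fst x)), (Rabs_minus_sym (snd x)). Qed.

Lemma supdist_refl (x : R * R) : supdist x x = 0.
Proof. unfold supdist; rewrite !Rminus_diag, Rabs_R0; apply Rmax_left; lra. Qed.

Lemma supdist_triangle (x x' x'' : R * R) :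
  supdist x x'' <= supdist x x' + supdist x' x''.
Proof.
apply supdist_le; split.
- replace (fst x - fst x'') with ((fst x - fst x') + (fst x' - fst x'')) by ring.
  eapply Rle_trans; [apply Rabs_triang |].
  apply Rplus_le_compat; apply fst_le_supdist.
- replace (snd x - snd x'') with ((snd x - snd x') + (snd x' - snd x'')) by ring.
  eapply Rle_trans; [apply Rabs_triang |].
  apply Rplus_le_compat; apply snd_le_supdist.
Qed.

Lemma supdist_eq0 (x x' : R * R) : supdist x x' <= 0 -> x = x'.
Proof.
intros [H1 H2]%supdist_le.
destruct x as [x1 x2], x' as [x1' x2']; simpl in *.
apply Rabs_le_between in H1; apply Rabs_le_between in H2.
f_equal; lra.
Qed.

(** The form in which compactness of a closed square is used below: a local lower
    bound for [h], valid off the exceptional set [P], becomes uniform. *)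
Lemma square_lower_bound (z : R * R) (r : R) (P : R * R -> Prop) (h : R * R -> R) :
  (forall t, supdist t z <= r -> exists e, 0 < e /\
     forall x, supdist x z <= r -> supdist x t < e -> P x \/ e <= h x) ->
  exists d, 0 < d /\ forall x, supdist x z <= r -> h x < d -> ~ ~ P x.
Proof.
intros Hloc.
assert (Hchoice : forall t, exists e : posreal, supdist t z <= r ->
  forall x, supdist x z <= r -> supdist x t < e -> P x \/ e <= h x).
{ intros t; destruct (Rle_dec (supdist t z) r) as [Ht | Ht].
  - destruct (Hloc t Ht) as (e & He & H).
    now exists (mkposreal e He).
  - now exists (mkposreal 1 Rlt_0_1). }
pose (D t := proj1_sig (constructive_indefinite_description _ (Hchoice t))).
assert (HD : forall t, supdist t z <= r ->
  forall x, supdist x z <= r -> supdist x t < D t -> P x \/ D t <= h x).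
{ intros t; unfold D; now destruct constructive_indefinite_description. }
destruct (compactness_value_2d (fst z - r) (fst z + r) (snd z - r) (snd z + r)
  (fun u v => D (u, v))) as [d Hd].
assert (Hbox : forall x, supdist x z <= r <->
  fst z - r <= fst x <= fst z + r /\ snd z - r <= snd x <= snd z + r).
{ intros x; rewrite supdist_le, !Rabs_le_between; lra. }
exists d; split; [apply cond_pos |].
intros x Hx Hhx HP.
destruct (proj1 (Hbox x) Hx) as [Hx1 Hx2].
apply (Hd _ _ Hx1 Hx2); intros (u & v & Hu & Hv & Hxu & Hxv & Hdt).
assert (Ht : supdist (u, v) z <= r) by (apply Hbox; simpl; lra).
assert (Hxt : supdist x (u, v) < D (u, v)).
{ unfold supdist; simpl; now apply Rmax_lub_lt. }
destruct (HD _ Ht x Hx Hxt); [now apply HP | lra].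
Qed.

(** If no point were fixed, compactness would bound the displacement
    [supdist (T x) x] away from zero, whereas iterating [T] halves it at each
    step. *)
Lemma contraction_fixed_point (T : R * R -> R * R) (z : R * R) (r : R) :
  0 <= r ->
  (forall x, supdist x z <= r -> supdist (T x) z <= r) ->
  (forall x x', supdist x z <= r -> supdist x' z <= r ->
     supdist (T x) (T x') <= / 2 * supdist x x') ->
  exists x, supdist x z <= r /\ T x = x.
Proof.
intros Hr Hself Hcontr.
apply NNPP; intros Hno.
destruct (square_lower_bound z r (fun _ => False) (fun x => supdist (T x) x))
  as (d & Hd & Hlow).
- intros t Ht.
  assert (Hpos : 0 < supdist (T t) t).
  { apply Rnot_le_lt; intros H0%supdist_eq0; apply Hno; now exists t. }
  exists (supdist (T t) t / 4); split; [lra |].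
  intros x Hx Hxt; right.
  pose proof (Hcontr t x Ht Hx) as Hc.
  pose proof (supdist_triangle (T t) (T x) t) as H1.
  pose proof (supdist_triangle (T x) x t) as H2.
  rewrite (supdist_sym t x) in Hc; lra.
- pose (xn := fix xn n := match n with O => z | S k => T (xn k) end).
  assert (Hxn : forall n, supdist (xn n) z <= r /\
    supdist (T (xn n)) (xn n) <= supdist (T z) z * (/ 2) ^ n).
  { induction n as [| n [IH1 IH2]]; simpl.
    - rewrite supdist_refl; lra.
    - split; [now apply Hself |].
      eapply Rle_trans; [apply Hcontr; [now apply Hself | exact IH1] |].
      lra. }
  destruct (pow_lt_1_zero (/ 2)) with (y := d / (supdist (T z) z + 1)) as [n Hn].
  + rewrite Rabs_pos_eq; lra.
  + apply Rdiv_lt_0_compat; [lra | pose proof (supdist_ge0 (T z) z); lra].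
  + specialize (Hn n (le_n n)).
    destruct (Hxn n) as [H1 H2].
    apply (Hlow (xn n) H1); [| easy].
    pose proof (supdist_ge0 (T z) z) as Hge.
    assert (Hp : 0 < (/ 2) ^ n) by (apply pow_lt; lra).
    rewrite Rabs_pos_eq in Hn by lra.
    apply Rlt_div_r in Hn; [| lra].
    nra.
Qed.

(** * Strict differentiability *)

(** Caratheodory's form of strict differentiability at [z] with gradient [(a, b)]:
    the difference quotients [m] and [n] depend on both points and are jointly
    continuous at [(z, z)].  The rules of calculus then reduce to algebraic
    identities and continuity, and every such [f] is nearly linear on differences
    of points close to [z], which is what a contraction argument needs. *)
Definition strict_diff (f : R * R -> R) (z : R * R) (a b : R) : Prop :=
  exists m n : (R * R) * (R * R) -> R,
    (forall x x', f x - f x' =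
       m (x, x') * (fst x - fst x') + n (x, x') * (snd x - snd x')) /\
    (continuous m (z, z) /\ m (z, z) = a) /\
    (continuous n (z, z) /\ n (z, z) = b).

Lemma strict_diff_eq (f : R * R -> R) (z : R * R) (a b a' b' : R) :
  strict_diff f z a b -> a = a' -> b = b' -> strict_diff f z a' b'.
Proof. now intros H <- <-. Qed.

Lemma strict_diff_const (c : R) (z : R * R) : strict_diff (fun _ => c) z 0 0.
Proof.
exists (fun _ => 0), (fun _ => 0); split; [intros; ring |].
split; (split; [apply continuous_const | reflexivity]).
Qed.

Lemma strict_diff_fst (z : R * R) : strict_diff fst z 1 0.
Proof.
exists (fun _ => 1), (fun _ => 0); split; [intros; ring |].
split; (split; [apply continuous_const | reflexivity]).
Qed.

Lemma strict_diff_snd (z : R * R) : strict_diff snd z 0 1.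
Proof.
exists (fun _ => 0), (fun _ => 1); split; [intros; ring |].
split; (split; [apply continuous_const | reflexivity]).
Qed.

Lemma strict_diff_continuous (f : R * R -> R) (z : R * R) (a b : R) :
  strict_diff f z a b -> continuous f z.
Proof.
intros (m & n & Hf & [Hm _] & [Hn _]).
apply (continuous_ext
  (fun x => f z + (m (x, z) * (fst x - fst z) + n (x, z) * (snd x - snd z)))).
{ intros x; rewrite <- Hf; simpl; ring. }
assert (Hpair : continuous (fun x : R * R => (x, z)) z).
{ intros P [e He]; exists e; intros x Hx; apply He; split; [exact Hx | apply ball_center]. }
apply (continuous_plus (fun _ => f z)); [apply continuous_const |].
destruct z as [z1 z2].
apply (continuous_plus (V := R_NormedModule)).
- apply (continuous_mult (K := R_AbsRing) (fun x => m (x, _))).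
  + now apply (continuous_comp (fun x : R * R => (x, (z1, z2))) m).
  + apply (continuous_minus (V := R_NormedModule)); [apply continuous_fst | apply continuous_const].
- apply (continuous_mult (K := R_AbsRing) (fun x => n (x, _))).
  + now apply (continuous_comp (fun x : R * R => (x, (z1, z2))) n).
  + apply (continuous_minus (V := R_NormedModule)); [apply continuous_snd | apply continuous_const].
Qed.

Lemma strict_diff_plus (f g : R * R -> R) (z : R * R) (a b c d : R) :
  strict_diff f z a b -> strict_diff g z c d ->
  strict_diff (fun x => f x + g x) z (a + c) (b + d).
Proof.
intros (m & n & Hf & [Hm <-] & [Hn <-]) (m' & n' & Hg & [Hm' <-] & [Hn' <-]).
exists (fun p => m p + m' p), (fun p => n p + n' p); split.
{ intros x x'; specialize (Hf x x'); specialize (Hg x x'); lra. }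
split; (split; [now apply (continuous_plus (V := R_NormedModule)) | reflexivity]).
Qed.

Lemma strict_diff_mult (f g : R * R -> R) (z : R * R) (a b c d : R) :
  strict_diff f z a b -> strict_diff g z c d ->
  strict_diff (fun x => f x * g x) z (a * g z + f z * c) (b * g z + f z * d).
Proof.
intros Df Dg.
pose proof (strict_diff_continuous _ _ _ _ Df) as Cf.
pose proof (strict_diff_continuous _ _ _ _ Dg) as Cg.
destruct Df as (m & n & Hf & [Hm <-] & [Hn <-]).
destruct Dg as (m' & n' & Hg & [Hm' <-] & [Hn' <-]).
assert (Cf' : continuous (fun p : (R * R) * (R * R) => f (fst p)) (z, z))
  by (apply continuous_comp; [apply continuous_fst | exact Cf]).
assert (Cg' : continuous (fun p : (R * R) * (R * R) => g (snd p)) (z, z))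
  by (apply continuous_comp; [apply continuous_snd | exact Cg]).
exists (fun p => m p * g (snd p) + f (fst p) * m' p),
  (fun p => n p * g (snd p) + f (fst p) * n' p); split.
{ intros x x'; simpl.
  replace (f x * g x - f x' * g x')
    with ((f x - f x') * g x' + f x * (g x - g x')) by ring.
  rewrite Hf, Hg; ring. }
split; (split; [| reflexivity]); apply (continuous_plus (V := R_NormedModule));
  now apply (continuous_mult (K := R_AbsRing)).
Qed.

Lemma strict_diff_inv (f : R * R -> R) (z : R * R) (a b : R) :
  (forall x, f x <> 0) -> strict_diff f z a b ->
  strict_diff (fun x => / f x) z (- a / f z ^ 2) (- b / f z ^ 2).
Proof.
intros Hnz Df.
pose proof (strict_diff_continuous _ _ _ _ Df) as Cf.
destruct Df as (m & n & Hf & [Hm <-] & [Hn <-]).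
assert (Cff : continuous (fun p : (R * R) * (R * R) => / f (fst p) * / f (snd p)) (z, z)).
{ apply (continuous_mult (K := R_AbsRing) (fun p => / f (fst p)) (fun p => / f (snd p))).
  - apply (continuous_comp (fun p => f (fst p)) Rinv); [| apply continuous_Rinv, Hnz].
    apply continuous_comp; [apply continuous_fst | exact Cf].
  - apply (continuous_comp (fun p => f (snd p)) Rinv); [| apply continuous_Rinv, Hnz].
    apply continuous_comp; [apply continuous_snd | exact Cf]. }
exists (fun p => - m p * (/ f (fst p) * / f (snd p))),
  (fun p => - n p * (/ f (fst p) * / f (snd p))); split.
{ intros x x'; simpl.
  replace (/ f x - / f x') with (- (f x - f x') * (/ f x * / f x'))
    by (field; split; apply Hnz).
  rewrite Hf; ring. }
split; (split; [| simpl; field; apply Hnz]);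
  apply (continuous_mult (K := R_AbsRing) (fun p => - _ p)); try exact Cff;
  now apply (continuous_opp (V := R_NormedModule)).
Qed.

Lemma strict_diff_approx (f : R * R -> R) (z : R * R) (a b : R) :
  strict_diff f z a b ->
  forall e, 0 < e -> exists r, 0 < r /\
    forall x x', supdist x z <= r -> supdist x' z <= r ->
      Rabs (a * (fst x - fst x') + b * (snd x - snd x') - (f x - f x'))
        <= e * supdist x x'.
Proof.
intros (m & n & Hf & [Hm <-] & [Hn <-]) e He.
assert (He2 : 0 < e / 2) by lra.
destruct (proj1 (filterlim_locally _ _) Hm (mkposreal _ He2)) as [r1 Hr1].
destruct (proj1 (filterlim_locally _ _) Hn (mkposreal _ He2)) as [r2 Hr2].
pose proof (cond_pos r1); pose proof (cond_pos r2).
assert (Hr : 0 < Rmin r1 r2) by (apply Rmin_pos; lra).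
pose proof (Rmin_l r1 r2); pose proof (Rmin_r r1 r2).
exists (Rmin r1 r2 / 2); split; [lra |].
assert (Hball : forall r x, Rmin r1 r2 / 2 < r -> supdist x z <= Rmin r1 r2 / 2 -> ball z r x).
{ intros r x Hlt [H3 H4]%supdist_le.
  split; eapply Rle_lt_trans; eassumption. }
intros x x' Hx Hx'.
assert (B1 : ball (m (z, z)) (e / 2) (m (x, x')))
  by (apply Hr1; split; apply Hball; (lra || assumption)).
assert (B2 : ball (n (z, z)) (e / 2) (n (x, x')))
  by (apply Hr2; split; apply Hball; (lra || assumption)).
apply Rlt_le in B1, B2.
change (Rabs (m (x, x') - m (z, z)) <= e / 2) in B1.
change (Rabs (n (x, x') - n (z, z)) <= e / 2) in B2.
rewrite Hf.
match goal with |- Rabs ?t <= _ => replace t with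
  (- ((m (x, x') - m (z, z)) * (fst x - fst x') +
      (n (x, x') - n (z, z)) * (snd x - snd x'))) by ring end.
rewrite Rabs_Ropp.
eapply Rle_trans; [apply Rabs_triang |]; rewrite !Rabs_mult.
replace (e * supdist x x') with (e / 2 * supdist x x' + e / 2 * supdist x x') by lra.
apply Rplus_le_compat; apply Rmult_le_compat; try apply Rabs_pos; try assumption;
  [apply fst_le_supdist | apply snd_le_supdist].
Qed.

(** * Inverse functions *)

(** Cramer's rule, read as a bound on the inverse of a 2x2 matrix. *)
Lemma linear_inverse_bound (a b c d : R) :
  a * d - b * c <> 0 ->
  exists C, 0 < C /\ forall h k e,
    Rabs (a * h + b * k) <= e -> Rabs (c * h + d * k) <= e ->
    Rabs h <= C * e /\ Rabs k <= C * e.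
Proof.
set (D := a * d - b * c); intros HD.
pose proof (Rabs_pos_lt D HD) as HD0.
pose proof (Rabs_pos a); pose proof (Rabs_pos b).
pose proof (Rabs_pos c); pose proof (Rabs_pos d).
exists ((Rabs a + Rabs b + Rabs c + Rabs d + 1) / Rabs D); split.
{ apply Rdiv_lt_0_compat; lra. }
intros h k e E1 E2.
pose proof (Rle_trans _ _ _ (Rabs_pos _) E1) as He.
assert (Hbound : forall x u v, Rabs u + Rabs v <= Rabs a + Rabs b + Rabs c + Rabs d ->
  D * x = u * (a * h + b * k) + v * (c * h + d * k) ->
  Rabs x <= (Rabs a + Rabs b + Rabs c + Rabs d + 1) / Rabs D * e).
{ intros x u v Huv Hx.
  replace (_ / Rabs D * e) with
    ((Rabs a + Rabs b + Rabs c + Rabs d + 1) * e / Rabs D) by (field; lra).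
  apply Rle_div_r; [exact HD0 |].
  rewrite Rmult_comm, <- Rabs_mult, Hx.
  eapply Rle_trans; [apply Rabs_triang |]; rewrite !Rabs_mult.
  pose proof (Rmult_le_compat_l _ _ _ (Rabs_pos u) E1).
  pose proof (Rmult_le_compat_l _ _ _ (Rabs_pos v) E2).
  nra. }
split.
- apply (Hbound h d (- b)); [rewrite Rabs_Ropp; lra | unfold D; ring].
- apply (Hbound k (- c) a); [rewrite Rabs_Ropp; lra | unfold D; ring].
Qed.

(** Near a point with invertible Jacobian, [F = (f, g)] differs from its
    linearization by a map of small Lipschitz constant.  Hence [F] expands distances
    there by a definite factor, which gives uniqueness and Lipschitz dependence at
    once, and each value close to [F z] is attained, by iterating Newton's map with
    fixed Jacobian.  One radius [r0] serves for uniqueness, while solutions exist in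
    all the smaller squares: several zeros can then share a common radius. *)
Lemma inverse_function (f g : R * R -> R) (z : R * R) (a b c d : R) :
  strict_diff f z a b -> strict_diff g z c d -> a * d - b * c <> 0 ->
  exists r0 K, 0 < r0 /\ 0 < K /\
    (forall x x', supdist x z <= r0 -> supdist x' z <= r0 ->
       supdist x x' <= K * supdist (f x, g x) (f x', g x')) /\
    (forall r p, 0 < r <= r0 -> K * supdist p (f z, g z) <= r ->
       exists x, supdist x z <= r /\ (f x, g x) = p).
Proof.
intros Df Dg HD.
destruct (linear_inverse_bound a b c d HD) as (C & HC & Hlin).
assert (He : 0 < / (2 * C)) by (apply Rinv_0_lt_compat; lra).
destruct (strict_diff_approx f z a b Df _ He) as (r1 & Hr1 & Hf).
destruct (strict_diff_approx g z c d Dg _ He) as (r2 & Hr2 & Hg).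
pose proof (Rmin_pos _ _ Hr1 Hr2) as Hr0.
pose proof (Rmin_l r1 r2) as Hl; pose proof (Rmin_r r1 r2) as Hr.
assert (HCe : forall t, C * (/ (2 * C) * t) = / 2 * t) by (intros; field; lra).
exists (Rmin r1 r2), (2 * C); split; [exact Hr0 |]; split; [lra |]; split.
- intros x x' Hx Hx'.
  set (e := supdist (f x, g x) (f x', g x')).
  assert (H : supdist x x' <= C * (/ (2 * C) * supdist x x' + e)).
  { apply supdist_le; apply Hlin.
    - specialize (Hf x x' ltac:(lra) ltac:(lra)).
      pose proof (fst_le_supdist (f x, g x) (f x', g x')) as H; simpl in H; fold e in H.
      apply Rabs_le_between in Hf; apply Rabs_le_between in H; apply Rabs_le_between; lra.
    - specialize (Hg x x' ltac:(lra) ltac:(lra)).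
      pose proof (snd_le_supdist (f x, g x) (f x', g x')) as H; simpl in H; fold e in H.
      apply Rabs_le_between in Hg; apply Rabs_le_between in H; apply Rabs_le_between; lra. }
  rewrite Rmult_plus_distr_l, HCe in H; lra.
- intros r p Hrr Hp.
  (* Newton's iteration with the Jacobian evaluated once and for all at [z]. *)
  pose (T x := (fst x - (d * (f x - fst p) - b * (g x - snd p)) / (a * d - b * c),
                snd x - (a * (g x - snd p) - c * (f x - fst p)) / (a * d - b * c))).
  assert (HT : forall x x', supdist x z <= r -> supdist x' z <= r ->
    supdist (T x) (T x') <= / 2 * supdist x x').
  { intros x x' Hx Hx'; rewrite <- HCe.
    apply supdist_le; apply Hlin.
    - specialize (Hf x x' ltac:(lra) ltac:(lra)).
      match goal with |- Rabs ?t <= _ => replace t with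
        (a * (fst x - fst x') + b * (snd x - snd x') - (f x - f x')); [exact Hf |] end.
      simpl; field; exact HD.
    - specialize (Hg x x' ltac:(lra) ltac:(lra)).
      match goal with |- Rabs ?t <= _ => replace t with
        (c * (fst x - fst x') + d * (snd x - snd x') - (g x - g x')); [exact Hg |] end.
      simpl; field; exact HD. }
  assert (HTz : supdist (T z) z <= C * supdist p (f z, g z)).
  { apply supdist_le; apply Hlin.
    - match goal with |- Rabs ?t <= _ => replace t with (fst p - f z) end.
      + apply (fst_le_supdist p (f z, g z)).
      + simpl; field; exact HD.
    - match goal with |- Rabs ?t <= _ => replace t with (snd p - g z) end.
      + apply (snd_le_supdist p (f z, g z)).
      + simpl; field; exact HD. }
  destruct (contraction_fixed_point T z r) as (x & Hx & HTx).
  + lra.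
  + intros x Hx.
    pose proof (supdist_triangle (T x) (T z) z).
    assert (Hz : supdist z z <= r) by (rewrite supdist_refl; lra).
    specialize (HT x z Hx Hz); lra.
  + exact HT.
  + exists x; split; [exact Hx |].
    assert (H1 : (d * (f x - fst p) - b * (g x - snd p)) / (a * d - b * c) = 0)
      by (apply (f_equal fst) in HTx; simpl in HTx; lra).
    assert (H2 : (a * (g x - snd p) - c * (f x - fst p)) / (a * d - b * c) = 0)
      by (apply (f_equal snd) in HTx; simpl in HTx; lra).
    destruct p as [p1 p2]; simpl in *; f_equal.
    * replace (f x) with (p1 + (a * ((d * (f x - p1) - b * (g x - p2)) / (a * d - b * c))
        + b * ((a * (g x - p2) - c * (f x - p1)) / (a * d - b * c)))) by (field; exact HD).
      rewrite H1, H2; ring.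
    * replace (g x) with (p2 + (c * ((d * (f x - p1) - b * (g x - p2)) / (a * d - b * c))
        + d * ((a * (g x - p2) - c * (f x - p1)) / (a * d - b * c)))) by (field; exact HD).
      rewrite H1, H2; ring.
Qed.

Definition along (z w : R * R) (s : R) : R * R :=
  (fst z + s * fst w, snd z + s * snd w).

(** A solution at distance [O(s)] from [z] has the expansion [z + s w + o(s)] with
    [J w = p], because the linearization error is [o(s)]. *)
Lemma inverse_first_order (f g : R * R -> R) (z w p : R * R) (a b c d K e : R) :
  strict_diff f z a b -> strict_diff g z c d -> a * d - b * c <> 0 ->
  a * fst w + b * snd w = fst p -> c * fst w + d * snd w = snd p ->
  0 < K -> 0 < e ->
  exists eta, 0 < eta /\ forall s x, 0 <= s < eta -> supdist x z <= K * s ->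
    (f x, g x) = along (f z, g z) p s -> supdist x (along z w s) <= e * s.
Proof.
intros Df Dg HD Hw1 Hw2 HK He.
destruct (linear_inverse_bound a b c d HD) as (C & HC & Hlin).
assert (He' : 0 < e / (C * K)) by (apply Rdiv_lt_0_compat; [lra | nra]).
destruct (strict_diff_approx f z a b Df _ He') as (r1 & Hr1 & Hf).
destruct (strict_diff_approx g z c d Dg _ He') as (r2 & Hr2 & Hg).
pose proof (Rmin_pos _ _ Hr1 Hr2) as Hr0.
pose proof (Rmin_l r1 r2) as Hl; pose proof (Rmin_r r1 r2) as Hr.
exists (Rmin r1 r2 / K); split; [now apply Rdiv_lt_0_compat |].
intros s x [Hs0 Hs] Hx HF.
injection HF; intros HFg HFf; simpl in HFf, HFg.
assert (Hxr : supdist x z <= Rmin r1 r2).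
{ apply Rlt_div_r in Hs; lra. }
assert (Hzz : forall r, 0 < r -> supdist z z <= r) by (intros; rewrite supdist_refl; lra).
specialize (Hf x z ltac:(lra) (Hzz _ Hr1)); specialize (Hg x z ltac:(lra) (Hzz _ Hr2)).
assert (Herr : e / (C * K) * supdist x z <= e / (C * K) * (K * s))
  by (apply Rmult_le_compat_l; lra).
replace (e * s) with (C * (e / (C * K) * (K * s))) by (field; lra).
apply supdist_le; apply Hlin; simpl.
- eapply Rle_trans; [| exact Herr]; eapply Rle_trans; [| exact Hf].
  right; f_equal; rewrite HFf, <- Hw1; ring.
- eapply Rle_trans; [| exact Herr]; eapply Rle_trans; [| exact Hg].
  right; f_equal; rewrite HFg, <- Hw2; ring.
Qed.

(** * Zeros under a small perturbation *)

Lemma index_uniform (P : index -> R -> Prop) :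
  (forall j r r', P j r -> 0 < r' <= r -> P j r') ->
  (forall j, exists r, 0 < r /\ P j r) ->
  exists r, 0 < r /\ forall j, P j r.
Proof.
intros Hmono Hex.
assert (Hlist : forall l, exists r, 0 < r /\ forall j, In j l -> P j r).
{ induction l as [| j l (r & Hr & IH)].
  - exists 1; split; [lra | easy].
  - destruct (Hex j) as (r' & Hr' & Hj).
    pose proof (Rmin_pos _ _ Hr Hr'); pose proof (Rmin_l r r'); pose proof (Rmin_r r r').
    exists (Rmin r r'); split; [easy |].
    intros k [<- | Hk].
    + now apply Hmono with r'.
    + now apply Hmono with r; [apply IH |]. }
destruct (Hlist (JZero :: map JPos (ModeL :: ModeR :: ModeX :: ModeY :: nil) ++
                 map JNeg (ModeL :: ModeR :: ModeX :: ModeY :: nil))) as (r & Hr & H).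
exists r; split; [exact Hr |].
intros j; apply H; destruct j as [| [] | []]; simpl; tauto.
Qed.

(** [w] is the velocity at which the zero [z] of [(f, g)] starts to move when the
    right-hand side is [s p] instead of [0]. *)
Definition regular_zero (f g : R * R -> R) (p z w : R * R) : Prop :=
  f z = 0 /\ g z = 0 /\ exists a b c d,
    strict_diff f z a b /\ strict_diff g z c d /\ a * d - b * c <> 0 /\
    a * fst w + b * snd w = fst p /\ c * fst w + d * snd w = snd p.

(** The second clause, the lower bound on the expansion of distances by [(f, g)],
    is what makes the branch the only solution near [z] and Lipschitz in [s]. *)
Definition is_branch (f g : R * R -> R) (p z w : R * R) (r ell : R)
    (x : R -> R * R) : Prop :=
  (forall s, 0 <= s < ell ->
     supdist (x s) z <= r /\ f (x s) = s * fst p /\ g (x s) = s * snd p) /\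
  (exists K, 0 < K /\ forall x x', supdist x z <= r -> supdist x' z <= r ->
     supdist x x' <= K * supdist (f x, g x) (f x', g x')) /\
  (forall e, 0 < e -> exists eta, 0 < eta /\
     forall s, 0 <= s < ell -> s < eta -> supdist (x s) (along z w s) <= e * s).

(** Coercivity confines the points with small [(f, g)] to a square; compactness of
    that square then excludes small values far from the zeros. *)
Lemma near_zero_of_small (f g : R * R -> R) (Z : index -> R * R) (B r : R) :
  (forall x, continuous f x) -> (forall x, continuous g x) ->
  (forall x, f x = 0 -> g x = 0 -> exists j, x = Z j) ->
  (forall x, Rabs (f x) <= 1 -> Rabs (g x) <= 1 -> supdist x (0, 0) <= B) ->
  0 < r ->
  exists d, 0 < d /\ forall x, Rabs (f x) < d -> Rabs (g x) < d ->
    exists j, supdist x (Z j) <= r.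
Proof.
intros Cf Cg HZ HB Hr.
destruct (square_lower_bound (0, 0) B (fun x => exists j, supdist x (Z j) <= r)
  (fun x => supdist (f x, g x) (0, 0))) as (d & Hd & Hlow).
- intros t _.
  pose proof (supdist_ge0 (f t, g t) (0, 0)) as [Hpos | Hzero].
  + set (h := supdist (f t, g t) (0, 0)) in *.
    assert (Hh : 0 < h / 2) by lra.
    destruct (proj1 (filterlim_locally _ _) (Cf t) (mkposreal _ Hh)) as [e1 He1].
    destruct (proj1 (filterlim_locally _ _) (Cg t) (mkposreal _ Hh)) as [e2 He2].
    pose proof (cond_pos e1) as P1; pose proof (cond_pos e2) as P2.
    pose proof (Rmin_pos _ _ P1 P2) as P12.
    pose proof (Rmin_l e1 e2) as Hl; pose proof (Rmin_r e1 e2) as Hr'.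
    exists (Rmin (Rmin e1 e2) (h / 2)); split; [now apply Rmin_pos |].
    intros x _ Hxt; right.
    pose proof (Rmin_l (Rmin e1 e2) (h / 2)); pose proof (Rmin_r (Rmin e1 e2) (h / 2)).
    pose proof (fst_le_supdist x t); pose proof (snd_le_supdist x t).
    assert (B1 : Rabs (f x - f t) < h / 2)
      by (apply He1; split; eapply Rle_lt_trans; try eassumption; lra).
    assert (B2 : Rabs (g x - g t) < h / 2)
      by (apply He2; split; eapply Rle_lt_trans; try eassumption; lra).
    assert (B3 : supdist (f t, g t) (f x, g x) < h / 2).
    { rewrite supdist_sym; now apply Rmax_lub_lt. }
    pose proof (supdist_triangle (f t, g t) (f x, g x) (0, 0)) as Htri.
    fold h in Htri; lra.
  + assert (H0 : (f t, g t) = (0, 0)) by (apply supdist_eq0; lra).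
    injection H0; intros Hg Hf.
    destruct (HZ t Hf Hg) as [j ->].
    exists r; split; [exact Hr |].
    intros x _ Hx; left; exists j; lra.
- exists (Rmin d 1); split; [apply Rmin_pos; lra |].
  pose proof (Rmin_l d 1); pose proof (Rmin_r d 1).
  intros x Hf Hg; apply NNPP; apply Hlow.
  + apply HB; lra.
  + unfold supdist; simpl; rewrite !Rminus_0_r; apply Rmax_lub_lt; lra.
Qed.

(** Each regular zero continues to a branch of solutions of [(f, g) = s p], and for
    small [s] there are no solutions elsewhere.  The radius [r] makes the squares
    around the zeros disjoint and small enough for uniqueness in each of them, so
    the branches exhaust the solutions and never meet. *)
Theorem perturbed_zeros (f g : R * R -> R) (p : R * R) (Z W : index -> R * R) (B : R) :
  (forall x, continuous f x) -> (forall x, continuous g x) ->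
  (forall x, f x = 0 -> g x = 0 -> exists j, x = Z j) ->
  (forall x, Rabs (f x) <= 1 -> Rabs (g x) <= 1 -> supdist x (0, 0) <= B) ->
  (forall j k, Z j = Z k -> j = k) ->
  (forall j, regular_zero f g p (Z j) (W j)) ->
  exists (r ell : R) (br : index -> R -> R * R),
    0 < ell /\
    (forall j, is_branch f g p (Z j) (W j) r ell (br j)) /\
    (forall s x, 0 <= s < ell -> f x = s * fst p -> g x = s * snd p ->
       exists j, supdist x (Z j) <= r) /\
    (forall j k x, supdist x (Z j) <= r -> supdist x (Z k) <= r -> j = k).
Proof.
intros Cf Cg HZ HB Hinj Hreg.
destruct (index_uniform (fun j r => exists K, 0 < K /\
    (forall x x', supdist x (Z j) <= r -> supdist x' (Z j) <= r ->
       supdist x x' <= K * supdist (f x, g x) (f x', g x')) /\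
    (forall r' q, 0 < r' <= r -> K * supdist q (0, 0) <= r' ->
       exists x, supdist x (Z j) <= r' /\ (f x, g x) = q))) as (r1 & Hr1 & Hinv).
{ intros j r r' (K & HK & H1 & H2) Hr'.
  exists K; split; [exact HK |]; split.
  - intros x x' Hx Hx'; apply H1; lra.
  - intros r'' q Hr'' Hq; apply H2; lra. }
{ intros j; destruct (Hreg j) as (Hf & Hg & a & b & c & d & Df & Dg & HD & _).
  destruct (inverse_function f g (Z j) a b c d Df Dg HD) as (r0 & K & Hr0 & HK & H1 & H2).
  rewrite Hf, Hg in H2.
  now exists r0; split; [| exists K]. }
destruct (index_uniform (fun j r => forall k, supdist (Z j) (Z k) <= r -> j = k))
  as (r2 & Hr2 & Hsep).
{ intros j r r' H Hr' k Hk; apply H; lra. }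
{ intros j; destruct (index_uniform (fun k r => supdist (Z j) (Z k) <= r -> j = k))
    as (r & Hr & H).
  - intros k r r' H Hr' Hk; apply H; lra.
  - intros k; destruct (classic (j = k)) as [Hjk | Hjk].
    + now exists 1; split; [lra |].
    + assert (Hpos : 0 < supdist (Z j) (Z k)).
      { apply Rnot_le_lt; intros H0%supdist_eq0; now apply Hjk, Hinj. }
      exists (supdist (Z j) (Z k) / 2); split; lra.
  - now exists r. }
set (r := Rmin r1 (r2 / 2)).
assert (Hr : 0 < r) by (apply Rmin_pos; lra).
assert (Hrr1 : r <= r1) by apply Rmin_l.
assert (Hrr2 : r <= r2 / 2) by apply Rmin_r.
destruct (near_zero_of_small f g Z B r Cf Cg HZ HB Hr) as (d & Hd & Hnear).
set (P := supdist p (0, 0)).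
assert (HP : 0 <= P) by apply supdist_ge0.
assert (HP1 : Rabs (fst p) <= P)
  by (rewrite <- (Rminus_0_r (fst p)); apply (fst_le_supdist p (0, 0))).
assert (HP2 : Rabs (snd p) <= P)
  by (rewrite <- (Rminus_0_r (snd p)); apply (snd_le_supdist p (0, 0))).
assert (Hsp : forall s v, 0 <= s -> Rabs v <= P -> Rabs (s * v) <= s * P).
{ intros s v Hs Hv; rewrite Rabs_mult, (Rabs_pos_eq s Hs).
  now apply Rmult_le_compat_l. }
destruct (index_uniform (fun j ell => forall s, 0 <= s < ell -> exists x,
  supdist x (Z j) <= r /\ f x = s * fst p /\ g x = s * snd p)) as (l1 & Hl1 & Hex).
{ intros j l l' H Hl' s Hs; apply H; lra. }
{ intros j; destruct (Hinv j) as (K & HK & _ & H).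
  exists (r / (K * (P + 1))); split; [apply Rdiv_lt_0_compat; nra |].
  intros s [Hs0 Hs].
  apply Rlt_div_r in Hs; [| nra].
  destruct (H r (s * fst p, s * snd p)) as (x & Hx & HF).
  - lra.
  - assert (Hq : supdist (s * fst p, s * snd p) (0, 0) <= s * P).
    { apply supdist_le; simpl; rewrite !Rminus_0_r; now split; apply Hsp. }
    apply (Rmult_le_compat_l K) in Hq; nra.
  - injection HF; intros; now exists x. }
set (ell := Rmin l1 (d / (P + 1))).
assert (Hell : 0 < ell) by (apply Rmin_pos; [lra | apply Rdiv_lt_0_compat; lra]).
assert (Hell1 : ell <= l1) by apply Rmin_l.
assert (Hell2 : ell <= d / (P + 1)) by apply Rmin_r.
assert (Hchoice : forall j s, exists x, 0 <= s < ell ->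
  supdist x (Z j) <= r /\ f x = s * fst p /\ g x = s * snd p).
{ intros j s; destruct (classic (0 <= s < ell)) as [Hs | Hs].
  - destruct (Hex j s) as [x Hx]; [lra | now exists x].
  - now exists (0, 0). }
pose (br j s := proj1_sig (constructive_indefinite_description _ (Hchoice j s))).
assert (Hbr : forall j s, 0 <= s < ell ->
  supdist (br j s) (Z j) <= r /\ f (br j s) = s * fst p /\ g (br j s) = s * snd p).
{ intros j s; unfold br; now destruct constructive_indefinite_description. }
exists r, ell, br; split; [exact Hell |]; split; [| split].
- intros j; destruct (Hinv j) as (K & HK & Hlip & _).
  split; [exact (Hbr j) |]; split.
  { exists K; split; [exact HK |].
    intros x x' Hx Hx'; apply Hlip; lra. }
  intros e He.
  destruct (Hreg j) as (Hf & Hg & a & b & c & d' & Df & Dg & HD & Hw1 & Hw2).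
  destruct (inverse_first_order f g (Z j) (W j) p a b c d' (K * (P + 1)) e
    Df Dg HD Hw1 Hw2) as (eta & Heta & H); [nra | exact He |].
  exists eta; split; [exact Heta |].
  intros s Hs Hse; destruct (Hbr j s Hs) as (Hb & Hb1 & Hb2).
  apply H; [lra | |].
  + assert (Hzz : supdist (Z j) (Z j) <= r1) by (rewrite supdist_refl; lra).
    eapply Rle_trans; [apply Hlip; [lra | exact Hzz] |].
    rewrite Hf, Hg, Hb1, Hb2, Rmult_assoc.
    apply Rmult_le_compat_l; [lra |].
    apply supdist_le; simpl; rewrite !Rminus_0_r.
    split; (eapply Rle_trans; [apply Hsp; [lra | eassumption] | nra]).
  + unfold along; simpl; rewrite Hf, Hg, Hb1, Hb2; f_equal; ring.
- intros s x [Hs0 Hs] H1 H2.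
  assert (HsP : s * P < d).
  { assert (Hsd : s < d / (P + 1)) by lra.
    apply Rlt_div_r in Hsd; lra. }
  apply Hnear; [rewrite H1 | rewrite H2];
    (eapply Rle_lt_trans; [apply Hsp; eassumption | exact HsP]).
- intros j k x Hj Hk; apply Hsep.
  pose proof (supdist_triangle (Z j) x (Z k)) as H.
  rewrite (supdist_sym (Z j) x) in H; lra.
Qed.

(** * The real amplitude equations and their zeros *)

Definition swap (x : R * R) : R * R := (snd x, fst x).

Definition detY (delta : R) (x : R * R) : R :=
  delta + (1 + delta) * (fst x ^ 2 + snd x ^ 2) + 4 * fst x ^ 2 * snd x ^ 2.

(** The factor is [1 - (N - n)], with [(N, n)] at its equilibrium value
    [y delta mu x]. *)
Definition balance_minus (delta mu : R) (x : R * R) : R :=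
  fst x * (1 - mu * (delta + 2 * snd x ^ 2) / detY delta x).

(** Exchanging the two amplitudes changes the sign of the equilibrium value of [n],
    so this is the amplitude [snd x] times [1 - (N + n)]. *)
Definition balance_plus (delta mu : R) (x : R * R) : R := balance_minus delta mu (swap x).

Lemma detY_gt0 (delta : R) (x : R * R) : 0 < delta -> 0 < detY delta x.
Proof. unfold detY; rewrite <- det_Y; apply det_Y_gt0. Qed.

Lemma detY_swap (delta : R) (x : R * R) : detY delta (swap x) = detY delta x.
Proof. unfold detY; simpl; ring. Qed.

Lemma strict_diff_swap (f : R * R -> R) (z : R * R) (a b : R) :
  strict_diff f (swap z) a b -> strict_diff (fun x => f (swap x)) z b a.
Proof.
intros (m & n & Hf & [Hm Ha] & [Hn Hb]).
assert (Cswap : continuous (fun p : (R * R) * (R * R) => (swap (fst p), swap (snd p))) (z, z)).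
{ intros P [e He]; exists e; intros [[x1 x2] [x1' x2']] [[H1 H2] [H3 H4]].
  now apply He. }
exists (fun p => n (swap (fst p), swap (snd p))), (fun p => m (swap (fst p), swap (snd p))).
split; [intros x x'; rewrite Hf; simpl; ring |].
split; (split; [| assumption]).
- now apply (continuous_comp (fun p => (swap (fst p), swap (snd p))) n).
- now apply (continuous_comp (fun p => (swap (fst p), swap (snd p))) m).
Qed.

Lemma strict_diff_ext (f g : R * R -> R) (z : R * R) (a b : R) :
  (forall x, f x = g x) -> strict_diff f z a b -> strict_diff g z a b.
Proof.
intros Hfg (m & n & Hf & H); exists m, n; split; [| exact H].
intros x x'; now rewrite <- !Hfg.
Qed.

Lemma strict_diff_balance_minus (delta mu : R) (z : R * R) :
  0 < delta ->
  strict_diff (balance_minus delta mu) z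
    (1 - mu * (delta + 2 * snd z ^ 2) / detY delta z
       + mu * (delta + 2 * snd z ^ 2) * fst z ^ 2 * (2 * (1 + delta) + 8 * snd z ^ 2)
         / detY delta z ^ 2)
    (mu * fst z * snd z *
       ((delta + 2 * snd z ^ 2) * (2 * (1 + delta) + 8 * fst z ^ 2) / detY delta z ^ 2
        - 4 / detY delta z)).
Proof.
intros Hd; pose proof (detY_gt0 delta z Hd) as HD.
(* The same functions, built from the operations that have a differentiation rule. *)
pose (D x := delta + ((1 + delta) * (fst x * fst x + snd x * snd x)
               + 4 * ((fst x * fst x) * (snd x * snd x)))).
assert (HDx : forall x, D x = detY delta x) by (intros; unfold D, detY; ring).
apply (strict_diff_ext (fun x =>
  fst x * (1 + - mu * ((delta + 2 * (snd x * snd x)) * / D x)))).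
{ intros x; unfold balance_minus; rewrite HDx; pose proof (detY_gt0 delta x Hd); field; lra. }
assert (HD0 : forall x, D x <> 0)
  by (intros x; rewrite HDx; pose proof (detY_gt0 delta x Hd); lra).
eapply strict_diff_eq.
{ repeat first [ apply strict_diff_fst | apply strict_diff_snd | apply strict_diff_const
    | apply strict_diff_inv; [exact HD0 |] | apply strict_diff_mult | apply strict_diff_plus ]. }
all: cbv beta; rewrite HDx; field; lra.
Qed.

Lemma strict_diff_balance_plus (delta mu : R) (z : R * R) (a b : R) :
  strict_diff (balance_minus delta mu) (swap z) a b -> strict_diff (balance_plus delta mu) z b a.
Proof. apply strict_diff_swap. Qed.

(** Since [(fst x)^2 (delta + 2 (snd x)^2) <= detY], the saturable term contributes at
    most [mu] to [fst x * balance_minus]; so [(fst x)^2 <= |fst x| + mu], whatever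
    the size of [snd x]. *)
Lemma balance_coercive (delta mu : R) (x : R * R) :
  0 < delta -> 0 < mu -> Rabs (balance_minus delta mu x) <= 1 -> Rabs (fst x) <= 1 + mu.
Proof.
intros Hd Hmu Hb.
pose proof (detY_gt0 delta x Hd) as HD.
assert (H1 : fst x ^ 2 * (delta + 2 * snd x ^ 2) <= detY delta x).
{ unfold detY; pose proof (pow2_ge_0 (fst x)) as P1; pose proof (pow2_ge_0 (snd x)) as P2.
  pose proof (Rmult_le_pos _ _ P1 P2); nra. }
assert (H2 : fst x * balance_minus delta mu x =
  fst x ^ 2 - mu * (fst x ^ 2 * (delta + 2 * snd x ^ 2) / detY delta x))
  by (unfold balance_minus; field; lra).
apply (Rmult_le_compat_r (/ detY delta x)) in H1; [| apply Rlt_le, Rinv_0_lt_compat, HD].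
rewrite Rinv_r in H1 by lra.
apply (Rmult_le_compat_l mu) in H1; [| lra].
assert (H3 : fst x * balance_minus delta mu x <= Rabs (fst x)).
{ eapply Rle_trans; [apply Rle_abs |]; rewrite Rabs_mult.
  pose proof (Rabs_pos (fst x)); nra. }
rewrite H2 in H3; unfold Rdiv in H3; rewrite <- (pow2_abs (fst x)) in H3 at 1.
pose proof (Rabs_pos (fst x)); nra.
Qed.

Lemma balance_eq0 (delta mu : R) (x : R * R) :
  0 < delta -> balance_minus delta mu x = 0 ->
  fst x = 0 \/ detY delta x = mu * (delta + 2 * snd x ^ 2).
Proof.
intros Hd H; pose proof (detY_gt0 delta x Hd) as HD.
destruct (Rmult_integral _ _ H) as [H0 | H0]; [now left | right].
replace (mu * (delta + 2 * snd x ^ 2))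
  with (mu * (delta + 2 * snd x ^ 2) / detY delta x * detY delta x) by (field; lra).
replace (mu * (delta + 2 * snd x ^ 2) / detY delta x) with 1 by lra; ring.
Qed.

(** The fields that persist without injection; [JNeg] is the opposite field. *)
Definition mode_zero (delta mu : R) (m : mode) : R * R :=
  let c := sqrt (delta * (mu - 1) / (1 + delta)) in
  let q := sqrt ((mu - 1) / 2) in
  match m with
  | ModeL => (c, 0)
  | ModeR => (0, c)
  | ModeX => (q, q)
  | ModeY => (q, - q)
  end.

Definition zero_of (delta mu : R) (j : index) : R * R :=
  match j with
  | JZero => (0, 0)
  | JPos m => mode_zero delta mu m
  | JNeg m => (- fst (mode_zero delta mu m), - snd (mode_zero delta mu m))
  end.

(** The velocity [w] of [regular_zero], i.e. the inverse Jacobian at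
    [zero_of delta mu j] applied to [p].  It is the same for opposite zeros since the
    equations are odd. *)
Definition slope_of (delta mu : R) (p : R * R) (j : index) : R * R :=
  let (a, b) := p in
  match j with
  | JZero => (- a / (mu - 1), - b / (mu - 1))
  | JPos ModeL | JNeg ModeL =>
      (mu * a / (2 * (mu - 1)), - (1 + delta) * b / (2 * (mu - 1)))
  | JPos ModeR | JNeg ModeR =>
      (- (1 + delta) * a / (2 * (mu - 1)), mu * b / (2 * (mu - 1)))
  | JPos ModeX | JNeg ModeX =>
      (((2 * mu + delta - 1) * a + (1 - delta) * b) / (4 * (mu - 1)),
       ((1 - delta) * a + (2 * mu + delta - 1) * b) / (4 * (mu - 1)))
  | JPos ModeY | JNeg ModeY =>
      (((2 * mu + delta - 1) * a + (delta - 1) * b) / (4 * (mu - 1)),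
       ((delta - 1) * a + (2 * mu + delta - 1) * b) / (4 * (mu - 1)))
  end.

Lemma zero_of_inj (delta mu : R) (j k : index) :
  0 < delta -> 1 < mu -> zero_of delta mu j = zero_of delta mu k -> j = k.
Proof.
intros Hd Hmu.
assert (Hc : 0 < sqrt (delta * (mu - 1) / (1 + delta)))
  by (apply sqrt_lt_R0, Rdiv_lt_0_compat; [apply Rmult_lt_0_compat |]; lra).
assert (Hq : 0 < sqrt ((mu - 1) / 2)) by (apply sqrt_lt_R0; lra).
destruct j as [| [] | []], k as [| [] | []]; simpl; intros H; try reflexivity;
  injection H; intros; exfalso; lra.
Qed.

Lemma pow2_eq_sqrt (t c : R) : t ^ 2 = c -> t = sqrt c \/ t = - sqrt c.
Proof.
intros <-; replace (t ^ 2) with (Rsqr t) by (unfold Rsqr; ring).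
rewrite sqrt_Rsqr_abs; unfold Rabs; destruct Rcase_abs; lra.
Qed.

(** If both amplitudes are nonzero, the two remaining factors force
    [delta + 2 (fst x)^2 = delta + 2 (snd x)^2], so the amplitudes agree up to sign;
    then [detY] factors as [(delta + 2 q) (1 + 2 q)], [q] being their common square,
    and [mu = 1 + 2 q]. *)
Lemma balance_zeros (delta mu : R) (x : R * R) :
  0 < delta -> 1 < mu -> balance_minus delta mu x = 0 -> balance_plus delta mu x = 0 ->
  exists j, x = zero_of delta mu j.
Proof.
intros Hd Hmu H1 H2.
apply balance_eq0 in H1; [| exact Hd].
apply balance_eq0 in H2; [| exact Hd]; rewrite detY_swap in H2.
destruct x as [x1 x2]; unfold detY in *; simpl fst in *; simpl snd in *.
assert (Haxis : forall t, delta + (1 + delta) * t ^ 2 = mu * delta ->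
  t = sqrt (delta * (mu - 1) / (1 + delta)) \/ t = - sqrt (delta * (mu - 1) / (1 + delta))).
{ intros t Ht; apply pow2_eq_sqrt; apply Rmult_eq_reg_r with (1 + delta); [| lra].
  field_simplify; lra. }
destruct H1 as [-> | H1], H2 as [-> | H2].
- now exists JZero.
- destruct (Haxis x2) as [-> | ->]; [lra | now exists (JPos ModeR) |].
  exists (JNeg ModeR); simpl; now rewrite Ropp_0.
- destruct (Haxis x1) as [-> | ->]; [lra | now exists (JPos ModeL) |].
  exists (JNeg ModeL); simpl; now rewrite Ropp_0.
- assert (Heq : x1 ^ 2 = x2 ^ 2) by nra.
  assert (Hx2 : x2 ^ 2 = (mu - 1) / 2).
  { rewrite Heq in H1; pose proof (pow2_ge_0 x2).
    apply Rmult_eq_reg_l with (2 * (delta + 2 * x2 ^ 2)); nra. }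
  rewrite Hx2 in Heq.
  destruct (pow2_eq_sqrt _ _ Heq) as [-> | ->], (pow2_eq_sqrt _ _ Hx2) as [-> | ->].
  + now exists (JPos ModeX).
  + now exists (JPos ModeY).
  + exists (JNeg ModeY); simpl; now rewrite Ropp_involutive.
  + now exists (JNeg ModeX).
Qed.

Lemma regular_zero_swap (delta mu : R) (p z w : R * R) :
  regular_zero (balance_minus delta mu) (balance_plus delta mu) p z w ->
  regular_zero (balance_minus delta mu) (balance_plus delta mu) (swap p) (swap z) (swap w).
Proof.
intros (Hf & Hg & a & b & c & d & Df & Dg & HD & Hw1 & Hw2).
split; [exact Hg |]; split; [destruct z; exact Hf |].
exists d, c, b, a; split; [| split; [| split; [| split]]].
  apply (strict_diff_ext (fun x => balance_plus delta mu (swap x))); [now intros [] |].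
  apply strict_diff_swap; destruct z; exact Dg.
- apply strict_diff_balance_plus; destruct z; exact Df.
- lra.
- simpl; lra.
- simpl; lra.
Qed.

(** The second row of the Jacobian is read off at the swapped point. *)
Lemma regular_zero_intro (delta mu : R) (p z w : R * R) (a b c d : R) :
  strict_diff (balance_minus delta mu) z a b ->
  strict_diff (balance_minus delta mu) (swap z) d c ->
  balance_minus delta mu z = 0 -> balance_minus delta mu (swap z) = 0 ->
  a * d - b * c <> 0 -> a * fst w + b * snd w = fst p -> c * fst w + d * snd w = snd p ->
  regular_zero (balance_minus delta mu) (balance_plus delta mu) p z w.
Proof.
intros Df Dg Hf Hg HD Hw1 Hw2.
split; [exact Hf |]; split; [exact Hg |].
exists a, b, c, d; repeat split; try assumption.
now apply strict_diff_balance_plus.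
Qed.

Lemma regular_zero_origin (delta mu : R) (p : R * R) :
  0 < delta -> 1 < mu ->
  regular_zero (balance_minus delta mu) (balance_plus delta mu) p
    (zero_of delta mu JZero) (slope_of delta mu p JZero).
Proof.
intros Hd Hmu; destruct p as [p1 p2].
assert (HD : detY delta (0, 0) = delta) by (unfold detY; simpl; ring).
assert (D0 : strict_diff (balance_minus delta mu) (0, 0) (1 - mu) 0).
{ eapply strict_diff_eq; [apply strict_diff_balance_minus; lra | |]; simpl fst; simpl snd;
    rewrite HD; field; lra. }
apply (regular_zero_intro delta mu _ _ _ _ _ _ _ D0 D0); simpl.
- unfold balance_minus; simpl; ring.
- unfold balance_minus; simpl; ring.
- nra.
- field; lra.
- field; lra.
Qed.

(** The Jacobian is diagonal on the axis, with one entry of each sign. *)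
Lemma regular_zero_axis (delta mu c : R) (p : R * R) :
  0 < delta -> 1 < mu -> c ^ 2 = delta * (mu - 1) / (1 + delta) ->
  regular_zero (balance_minus delta mu) (balance_plus delta mu) p
    (c, 0) (slope_of delta mu p (JPos ModeL)).
Proof.
intros Hd Hmu Hc; destruct p as [p1 p2].
assert (HD : detY delta (c, 0) = mu * delta)
  by (unfold detY; simpl fst; simpl snd; rewrite Hc; field; lra).
assert (D1 : strict_diff (balance_minus delta mu) (c, 0) (2 * (mu - 1) / mu) 0).
{ eapply strict_diff_eq; [apply strict_diff_balance_minus; lra | |]; simpl fst; simpl snd;
    rewrite HD, ?Hc; field; lra. }
assert (D2 : strict_diff (balance_minus delta mu) (swap (c, 0)) (- 2 * (mu - 1) / (1 + delta)) 0).
{ eapply strict_diff_eq; [apply strict_diff_balance_minus; lra | |];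
    rewrite detY_swap, HD; simpl fst; simpl snd; rewrite ?Hc; field; lra. }
apply (regular_zero_intro delta mu _ _ _ _ _ _ _ D1 D2).
- unfold balance_minus; rewrite HD; simpl; field; lra.
- unfold balance_minus; simpl; ring.
- assert (0 < 2 * (mu - 1) / mu) by (apply Rdiv_lt_0_compat; lra).
  assert (0 < 2 * (mu - 1) / (1 + delta)) by (apply Rdiv_lt_0_compat; lra).
  replace (- 2 * (mu - 1) / (1 + delta)) with (- (2 * (mu - 1) / (1 + delta)))
    by (field; lra).
  nra.
- simpl; field; lra.
- simpl; field; lra.
Qed.

(** The Jacobian is symmetric with equal diagonal entries, so it has eigenvalues
    [A + B] and [A - B]; their product is positive because [2 mu + delta - 1]
    exceeds [|delta - 1|]. The sign [sg] distinguishes the modes X and Y. *)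
Lemma regular_zero_diag (delta mu q sg : R) (p : R * R) :
  0 < delta -> 1 < mu -> q ^ 2 = (mu - 1) / 2 -> sg ^ 2 = 1 ->
  regular_zero (balance_minus delta mu) (balance_plus delta mu) p (q, sg * q)
    (((2 * mu + delta - 1) * fst p + sg * (1 - delta) * snd p) / (4 * (mu - 1)),
     (sg * (1 - delta) * fst p + (2 * mu + delta - 1) * snd p) / (4 * (mu - 1))).
Proof.
intros Hd Hmu Hq Hsg; destruct p as [p1 p2]; simpl fst; simpl snd.
assert (Hq' : (sg * q) ^ 2 = (mu - 1) / 2)
  by (rewrite Rpow_mult_distr, Hsg; lra).
assert (HD : detY delta (q, sg * q) = mu * (delta + mu - 1))
  by (unfold detY; simpl fst; simpl snd; rewrite Hq, Hq'; field).
set (A := (mu - 1) * (2 * mu + delta - 1) / (mu * (delta + mu - 1))).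
set (B := sg * ((mu - 1) * (delta - 1) / (mu * (delta + mu - 1)))).
assert (Hqq : q * (sg * q) = sg * ((mu - 1) / 2)) by (rewrite <- Hq; ring).
assert (D1 : strict_diff (balance_minus delta mu) (q, sg * q) A B).
{ eapply strict_diff_eq; [apply strict_diff_balance_minus; lra | |]; simpl fst; simpl snd.
  - rewrite HD, ?Hq', ?Hq; unfold A; field; lra.
  - rewrite (Rmult_assoc mu q), Hqq, HD, ?Hq', ?Hq; unfold B; field; lra. }
assert (D2 : strict_diff (balance_minus delta mu) (swap (q, sg * q)) A B).
{ eapply strict_diff_eq; [apply strict_diff_balance_minus; lra | |]; rewrite detY_swap;
    simpl fst; simpl snd.
  - rewrite HD, ?Hq', ?Hq; unfold A; field; lra.
  - rewrite (Rmult_assoc mu), (Rmult_comm (sg * q)), Hqq, HD, ?Hq', ?Hq; unfold B; field; lra. }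
assert (HAB : A * A - B * B = 4 * (mu - 1) ^ 2 / (mu * (delta + mu - 1))).
{ replace (B * B) with (sg ^ 2 * ((mu - 1) * (delta - 1) / (mu * (delta + mu - 1))) ^ 2)
    by (unfold B; ring).
  rewrite Hsg; unfold A; field; lra. }
assert (HBs : B * sg = (mu - 1) * (delta - 1) / (mu * (delta + mu - 1))).
{ unfold B; rewrite Rmult_comm, <- Rmult_assoc.
  replace (sg * sg) with (sg ^ 2) by ring; rewrite Hsg; ring. }
apply (regular_zero_intro delta mu _ _ _ _ _ _ _ D1 D2).
- unfold balance_minus; rewrite HD; simpl fst; simpl snd; rewrite Hq'; field; lra.
- unfold balance_minus; rewrite detY_swap, HD; simpl fst; simpl snd; rewrite Hq; field; lra.
- rewrite HAB; apply Rgt_not_eq, Rdiv_lt_0_compat; [| apply Rmult_lt_0_compat; lra].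
  apply Rmult_lt_0_compat; [lra | apply pow_lt; lra].
- simpl.
  replace (A * (((2 * mu + delta - 1) * p1 + sg * (1 - delta) * p2) / (4 * (mu - 1))) +
    B * ((sg * (1 - delta) * p1 + (2 * mu + delta - 1) * p2) / (4 * (mu - 1))))
  with ((A * (2 * mu + delta - 1) + B * sg * (1 - delta)) * p1 / (4 * (mu - 1)) +
    (A * sg * (1 - delta) + B * (2 * mu + delta - 1)) * p2 / (4 * (mu - 1))) by (field; lra).
  rewrite HBs; unfold A, B; field; lra.
- simpl.
  replace (B * (((2 * mu + delta - 1) * p1 + sg * (1 - delta) * p2) / (4 * (mu - 1))) +
    A * ((sg * (1 - delta) * p1 + (2 * mu + delta - 1) * p2) / (4 * (mu - 1))))
  with ((A * (2 * mu + delta - 1) + B * sg * (1 - delta)) * p2 / (4 * (mu - 1)) +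
    (A * sg * (1 - delta) + B * (2 * mu + delta - 1)) * p1 / (4 * (mu - 1))) by (field; lra).
  rewrite HBs; unfold A, B; field; lra.
Qed.

Lemma regular_zero_of (delta mu : R) (p : R * R) (j : index) :
  0 < delta -> 1 < mu ->
  regular_zero (balance_minus delta mu) (balance_plus delta mu) p
    (zero_of delta mu j) (slope_of delta mu p j).
Proof.
intros Hd Hmu.
assert (Hc : sqrt (delta * (mu - 1) / (1 + delta)) ^ 2 = delta * (mu - 1) / (1 + delta)).
{ apply pow2_sqrt, Rlt_le, Rdiv_lt_0_compat; [apply Rmult_lt_0_compat |]; lra. }
assert (Hq : sqrt ((mu - 1) / 2) ^ 2 = (mu - 1) / 2) by (apply pow2_sqrt; lra).
assert (HcN : (- sqrt (delta * (mu - 1) / (1 + delta))) ^ 2 = delta * (mu - 1) / (1 + delta))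
  by (etransitivity; [| exact Hc]; ring).
assert (HqN : (- sqrt ((mu - 1) / 2)) ^ 2 = (mu - 1) / 2) 
  by (etransitivity; [| exact Hq]; ring).
assert (Hdiag : forall q sg q' w, q ^ 2 = (mu - 1) / 2 -> sg ^ 2 = 1 -> q' = sg * q ->
  w = (((2 * mu + delta - 1) * fst p + sg * (1 - delta) * snd p) / (4 * (mu - 1)),
       (sg * (1 - delta) * fst p + (2 * mu + delta - 1) * snd p) / (4 * (mu - 1))) ->
  regular_zero (balance_minus delta mu) (balance_plus delta mu) p (q, q') w)
  by (intros; subst; now apply regular_zero_diag).
destruct p as [p1 p2].
assert (Haxis : forall c, c ^ 2 = delta * (mu - 1) / (1 + delta) ->
  regular_zero (balance_minus delta mu) (balance_plus delta mu) (p1, p2)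
    (0, c) (slope_of delta mu (p1, p2) (JPos ModeR))).
{ intros c Hc'; exact (regular_zero_swap _ _ _ _ _ (regular_zero_axis _ _ _ (p2, p1) Hd Hmu Hc')). }
destruct j as [| [] | []]; simpl zero_of; rewrite ?Ropp_0.
- now apply regular_zero_origin.
- now apply regular_zero_axis.
- now apply Haxis.
- apply (Hdiag _ 1); [exact Hq | ring | ring |]; simpl; f_equal; field; lra.
- apply (Hdiag _ (-1)); [exact Hq | ring | ring |]; simpl; f_equal; field; lra.
- now apply regular_zero_axis.
- now apply Haxis.
- apply (Hdiag _ 1); [exact HqN | ring | ring |]; simpl; f_equal; field; lra.
- apply (Hdiag _ (-1)); [exact HqN | ring | ring |]; simpl; f_equal; field; lra.
Qed.

(** * Reduction of the equilibrium equations to real amplitudes *)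

Lemma Cmod_cis (t : R) : Cmod (cis t) = 1.
Proof.
unfold Cmod, cis; simpl.
transitivity (sqrt 1); [f_equal | exact sqrt_1].
pose proof (sin2_cos2 t); unfold Rsqr in *; lra.
Qed.

Lemma cis_mult_neg (t : R) : Cmult (cis t) (cis (- t)) = 1.
Proof.
unfold cis, Cmult; simpl; rewrite cos_neg, sin_neg.
pose proof (sin2_cos2 t); unfold Rsqr in *; unfold RtoC; f_equal; lra.
Qed.

Lemma one_plus_Ci_neq0 (alpha : R) : (1 + Ci * alpha)%C <> 0.
Proof. intros H; apply (f_equal fst) in H; simpl in H; lra. Qed.

Lemma Cmod_Csgn (u : C) : u <> 0 -> Cmod (Csgn u) = 1.
Proof.
intros Hu; pose proof (proj1 (Cmod_gt_0 u) Hu) as H.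
unfold Csgn; rewrite Cmod_div, Cmod_R, Rabs_pos_eq; [field; lra | lra |].
intros H0; apply RtoC_inj in H0; lra.
Qed.

Lemma Csgn_Cmod (u : C) : u <> 0 -> u = (Csgn u * Cmod u)%C.
Proof.
intros Hu; pose proof (proj1 (Cmod_gt_0 u) Hu) as H.
unfold Csgn; field.
intros H0; apply RtoC_inj in H0; lra.
Qed.

(** The factor common to all equilibrium fields; it has modulus one for
    [lambda <> 0]. *)
Definition phase (alpha : R) (lambda : C) : C :=
  (cis (- Carg (1 + Ci * alpha)%C) * (lambda / Cmod lambda))%C.

Definition field_of (alpha : R) (uh : C * C) (lambda : C) (x : R * R) : C * C :=
  scal (phase alpha lambda) ((Csgn (fst uh) * fst x)%C, (Csgn (snd uh) * snd x)%C).

Lemma Cmod_phase (alpha : R) (lambda : C) : lambda <> 0 -> Cmod (phase alpha lambda) = 1.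
Proof.
intros Hl; unfold phase; change (lambda / Cmod lambda)%C with (Csgn lambda).
rewrite Cmod_mult, Cmod_cis, Cmod_Csgn by exact Hl; ring.
Qed.

(** [phase] turns multiplication by [1 + i alpha] into multiplication by a positive
    number, up to the phase of [lambda]. *)
Lemma phase_spec (alpha : R) (lambda : C) :
  lambda <> 0 ->
  ((1 + Ci * alpha) * phase alpha lambda * Cmod lambda =
   Cmod (1 + Ci * alpha) * lambda)%C.
Proof.
intros Hl.
destruct (Carg_spec _ (one_plus_Ci_neq0 alpha)) as [HA _].
set (A := (1 + Ci * alpha)%C) in *.
transitivity (Cmod A * (cis (Carg A) * cis (- Carg A)) * (Csgn lambda * Cmod lambda))%C.
- unfold phase; fold A; rewrite HA at 1; unfold Csgn; ring.
- rewrite cis_mult_neg, <- (Csgn_Cmod lambda Hl); ring.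
Qed.

(** The gain factor [G] is real, and cannot vanish since [lambda u <> 0]; therefore
    [e] has the phase of [lambda u / (1 + i alpha)] up to a sign, which the real
    amplitude [t] carries. *)
Lemma real_amplitude (alpha G : R) (u lambda e : C) :
  u <> 0 -> lambda <> 0 ->
  ((1 + Ci * alpha) * (G * e) = lambda * u)%C <->
  exists t : R, e = (phase alpha lambda * (Csgn u * t))%C /\
    t * G = Cmod lambda * (Cmod u / Cmod (1 + Ci * alpha)).
Proof.
intros Hu Hl.
pose proof (phase_spec alpha lambda Hl) as HP.
pose proof (one_plus_Ci_neq0 alpha) as HA.
pose proof (Csgn_Cmod u Hu) as Hsu.
set (A := (1 + Ci * alpha)%C) in *; set (P := phase alpha lambda) in *.
pose proof (proj1 (Cmod_gt_0 A) HA) as HA0.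
pose proof (proj1 (Cmod_gt_0 u) Hu) as Hu0.
pose proof (proj1 (Cmod_gt_0 lambda) Hl) as Hl0.
assert (HCA : RtoC (Cmod A) <> 0) by (intros H; apply RtoC_inj in H; lra).
assert (HCl : RtoC (Cmod lambda) <> 0) by (intros H; apply RtoC_inj in H; lra).
assert (Hlam : lambda = (A * P * Cmod lambda / Cmod A)%C) by (rewrite HP; field; exact HCA).
split.
- intros He.
  assert (HG : G <> 0).
  { intros ->; assert (H0 : (lambda * u = 0)%C) by (rewrite <- He; ring).
    apply (f_equal Cmod) in H0; rewrite Cmod_mult, Cmod_0 in H0; nra. }
  assert (HCG : RtoC G <> 0) by (intros H; now apply RtoC_inj in H).
  exists (Cmod lambda * (Cmod u / Cmod A) / G); split; [| field; lra].
  rewrite RtoC_div, RtoC_mult, RtoC_div by (exact HG || lra).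
  replace e with (lambda * u / (A * G))%C by (rewrite <- He; field; now split).
  rewrite Hsu at 1; rewrite Hlam at 1; field; now repeat split.
- intros (t & -> & Ht).
  transitivity (A * P * Csgn u * (t * G)%R)%C; [rewrite RtoC_mult; ring |].
  rewrite Ht, RtoC_mult, RtoC_div by lra.
  rewrite Hsu at 3; rewrite Hlam at 2; field; exact HCA.
Qed.

Lemma y_detY (delta mu : R) (x : R * R) :
  0 < delta ->
  y delta mu x =
  (mu * (delta + (fst x ^ 2 + snd x ^ 2)) / detY delta x,
   mu * (fst x ^ 2 - snd x ^ 2) / detY delta x).
Proof.
intros Hd; pose proof (detY_gt0 delta x Hd) as HD.
rewrite yE, det_Y by exact Hd; fold (detY delta x).
match goal with |- scal ?c (?a, ?b) = _ =>
  change (scal c (a, b)) with (c * a, c * b) end.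
f_equal; field; lra.
Qed.

Lemma y_abs (delta mu : R) (x : R * R) :
  0 < delta -> y delta mu (Rabs (fst x), Rabs (snd x)) = y delta mu x.
Proof.
intros Hd; rewrite !y_detY by exact Hd.
unfold detY; simpl fst; simpl snd; now rewrite !pow2_abs.
Qed.

Lemma Y_Cmod (delta : R) (E : C * C) :
  Y delta E = Y delta (RtoC (Cmod (fst E)), RtoC (Cmod (snd E))).
Proof.
unfold Y; rewrite !norm2_sqr; simpl fst; simpl snd.
now rewrite !Cmod_R, !(Rabs_pos_eq (Cmod _)) by apply Cmod_ge_0.
Qed.

Lemma rhs_Nn_eq0 (gamma delta mu : R) (E : C * C) (N n : R) :
  0 < gamma -> 0 < delta ->
  rhs_Nn gamma delta mu E N n = (0, 0) <->
  (N, n) = y delta mu (Cmod (fst E), Cmod (snd E)).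
Proof.
intros Hg Hd; unfold rhs_Nn; rewrite Y_Cmod.
set (x := (Cmod (fst E), Cmod (snd E))).
change (Cmod (fst E)) with (fst x); change (Cmod (snd E)) with (snd x).
clearbody x; clear E; split; intros H.
- pose proof (detY_gt0 delta x Hd) as HD.
  rewrite y_detY by exact Hd; revert H; rewrite Y_real, matvecE; intros H.
  injection H as H1 H2.
  unfold plus, mult, opp, scal in H1, H2; simpl in H1, H2; unfold mult in H1, H2; simpl in H1, H2.
  apply Rmult_integral in H1; apply Rmult_integral in H2.
  destruct H1 as [H1 | H1]; [lra |]; destruct H2 as [H2 | H2]; [lra |].
  destruct x as [x1 x2]; simpl fst in *; simpl snd in *.
  f_equal; apply Rmult_eq_reg_r with (detY delta (x1, x2)); try lra;
    unfold Rdiv; rewrite Rmult_assoc, Rinv_l, Rmult_1_r by lra;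
    unfold detY; simpl fst; simpl snd.
  + apply (f_equal (Rmult (delta + (x1 ^ 2 + x2 ^ 2)))) in H1.
    apply (f_equal (Rmult (x2 ^ 2 - x1 ^ 2))) in H2; lra.
  + apply (f_equal (Rmult (x2 ^ 2 - x1 ^ 2))) in H1.
    apply (f_equal (Rmult (1 + (x1 ^ 2 + x2 ^ 2)))) in H2; lra.
- rewrite H, Y_y by exact Hd.
  unfold scal, minus, plus, opp, mult; simpl.
  unfold prod_scal, prod_plus, prod_opp, scal, plus, opp; simpl; unfold mult; simpl.
  f_equal; ring.
Qed.

Lemma rhs_E_eq0 (kappa alpha : R) (u E : C * C) (N n : R) :
  0 < kappa ->
  rhs_E kappa alpha u E N n = (RtoC 0, RtoC 0) <->
  ((1 + Ci * alpha) * (RtoC (1 - (N - n)) * fst E) = fst u)%C /\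
  ((1 + Ci * alpha) * (RtoC (1 - (N + n)) * snd E) = snd u)%C.
Proof.
intros Hk; destruct u as [u1 u2], E as [E1 E2].
assert (HCk : RtoC (- kappa) <> 0) by (intros H; apply RtoC_inj in H; lra).
assert (Heq : rhs_E kappa alpha (u1, u2) (E1, E2) N n =
  (RtoC (- kappa) * ((1 + Ci * alpha) * (RtoC (1 - (N - n)) * E1) - u1),
   RtoC (- kappa) * ((1 + Ci * alpha) * (RtoC (1 - (N + n)) * E2) - u2))%C).
{ unfold rhs_E, X; simpl fst; simpl snd; rewrite matvecE.
  unfold scal, minus, plus, opp, mult; simpl.
  unfold prod_scal, prod_plus, prod_opp, scal, plus, opp; simpl; unfold mult; simpl.
  rewrite !RtoC_minus, !RtoC_plus, ?RtoC_minus; f_equal; ring. }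
assert (Hcancel : forall v w : C, (RtoC (- kappa) * (v - w) = 0)%C <-> v = w).
{ intros v w; split.
  - intros H; assert (Hvw : (v - w = 0)%C).
    { destruct (Ceq_dec (v - w) 0) as [| Hne]; [assumption |].
      now destruct (Cmult_neq_0 _ _ HCk Hne). }
    replace v with (v - w + w)%C by ring; rewrite Hvw; ring.
  - intros ->; ring. }
rewrite Heq; split.
- intros H; split; apply Hcancel; [exact (f_equal fst H) | exact (f_equal snd H)].
- intros [H1 H2]; apply Hcancel in H1, H2; simpl fst in *; simpl snd in *.
  now rewrite H1, H2.
Qed.

(** Only the moduli of the fields enter the carrier equations, and these are
    the absolute values of the real amplitudes: eliminating [N] and [n] leaves two
    real equations for two real unknowns. *)
Lemma equilibrium_balance (kappa gamma delta alpha mu : R) (uh : C * C)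
    (lambda : C) (E : C * C) (N n : R) :
  0 < kappa -> 0 < gamma -> 0 < delta ->
  fst uh <> 0 -> snd uh <> 0 -> lambda <> 0 ->
  is_equilibrium kappa gamma delta alpha mu (scal lambda uh) E N n <->
  (exists x, E = field_of alpha uh lambda x /\
     balance_minus delta mu x = Cmod lambda * (Cmod (fst uh) / Cmod (1 + Ci * alpha)) /\
     balance_plus delta mu x = Cmod lambda * (Cmod (snd uh) / Cmod (1 + Ci * alpha))) /\
  (N, n) = y delta mu (Cmod (fst E), Cmod (snd E)).
Proof.
intros Hk Hg Hd Hum Hup Hl; unfold is_equilibrium.
rewrite rhs_E_eq0, rhs_Nn_eq0 by assumption.
destruct uh as [um up], E as [E1 E2]; simpl fst in *; simpl snd in *.
change (scal lambda um) with (lambda * um)%C; change (scal lambda up) with (lambda * up)%C.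
rewrite !real_amplitude by assumption.
assert (Hmod : forall (u : C) (t : R), u <> 0 ->
  Cmod (phase alpha lambda * (Csgn u * RtoC t)) = Rabs t).
{ intros u t Hu.
  rewrite !Cmod_mult, Cmod_phase, Cmod_Csgn, Cmod_R by assumption; ring. }
assert (Hgain : forall x, (N, n) = y delta mu (Rabs (fst x), Rabs (snd x)) ->
  fst x * (1 - (N - n)) = balance_minus delta mu x /\
  snd x * (1 - (N + n)) = balance_plus delta mu x).
{ intros x; rewrite y_abs, y_detY by exact Hd.
  pose proof (detY_gt0 delta x Hd) as HD.
  intros H; injection H as -> ->.
  unfold balance_plus, balance_minus; rewrite detY_swap; simpl; split; field; lra. }
split; intros [HE Hy]; (split; [| exact Hy]).
- destruct HE as [(t1 & -> & Ht1) (t2 & -> & Ht2)].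
  rewrite !Hmod in Hy by assumption.
  destruct (Hgain (t1, t2) Hy) as [G1 G2].
  exists (t1, t2); split; [reflexivity |].
  rewrite <- G1, <- G2; now split.
- destruct HE as (x & HE & Hx1 & Hx2).
  assert (HE1 : E1 = (phase alpha lambda * (Csgn um * fst x))%C) by exact (f_equal fst HE).
  assert (HE2 : E2 = (phase alpha lambda * (Csgn up * snd x))%C) by exact (f_equal snd HE).
  subst E1 E2.
  rewrite !Hmod in Hy by assumption.
  destruct (Hgain x Hy) as [G1 G2].
  split; [exists (fst x) | exists (snd x)]; (split; [reflexivity |]).
  + now rewrite G1.
  + now rewrite G2.
Qed.

(** * Continuity, asymptotics and symmetry of the branches *)

Lemma is_branch_continuous (f g : R * R -> R) (p z w : R * R) (r ell s : R)
    (x : R -> R * R) :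
  is_branch f g p z w r ell x -> 0 < s < ell -> continuous x s.
Proof.
intros (Hx & (K & HK & Hlip) & _) Hs.
set (P := supdist p (0, 0)).
assert (HP : 0 <= P) by apply supdist_ge0.
apply filterlim_locally; intros e.
assert (Heta : 0 < e / (K * (P + 1))) by (apply Rdiv_lt_0_compat; [apply cond_pos | nra]).
assert (Hd : 0 < Rmin (e / (K * (P + 1))) (Rmin s (ell - s)))
  by (repeat apply Rmin_pos; lra).
exists (mkposreal _ Hd); intros t Ht.
change (Rabs (t - s) < Rmin (e / (K * (P + 1))) (Rmin s (ell - s))) in Ht.
pose proof (Rmin_l (e / (K * (P + 1))) (Rmin s (ell - s))).
pose proof (Rmin_r (e / (K * (P + 1))) (Rmin s (ell - s))).
pose proof (Rmin_l s (ell - s)); pose proof (Rmin_r s (ell - s)).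
assert (Hts : Rabs (t - s) * (K * (P + 1)) < e) by (apply Rlt_div_r; [nra | lra]).
assert (Ht' : 0 <= t < ell) by (apply Rabs_lt_between in Ht; lra).
destruct (Hx t Ht') as (T0 & T1 & T2).
destruct (Hx s ltac:(lra)) as (S0 & S1 & S2).
specialize (Hlip (x t) (x s) T0 S0); rewrite T1, T2, S1, S2 in Hlip.
assert (HF : supdist (t * fst p, t * snd p) (s * fst p, s * snd p) <= Rabs (t - s) * P).
{ pose proof (fst_le_supdist p (0, 0)) as H3; pose proof (snd_le_supdist p (0, 0)) as H4.
  simpl in H3, H4; rewrite Rminus_0_r in H3, H4.
  apply supdist_le; simpl; rewrite <- !Rmult_minus_distr_r, !Rabs_mult.
  split; apply Rmult_le_compat_l; (apply Rabs_pos || assumption). }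
pose proof (Rabs_pos (t - s)).
assert (Hfin : supdist (x t) (x s) < e).
{ apply (Rmult_le_compat_l K) in HF; nra. }
split; (eapply Rle_lt_trans; [| exact Hfin]); [apply fst_le_supdist | apply snd_le_supdist].
Qed.

Lemma continuous_pair {T U V : UniformSpace} (f : T -> U) (g : T -> V) (t : T) :
  continuous f t -> continuous g t -> continuous (fun s => (f s, g s)) t.
Proof.
intros Hf Hg; apply filterlim_locally; intros e.
generalize (filter_and _ _ (proj1 (filterlim_locally _ _) Hf e)
  (proj1 (filterlim_locally _ _) Hg e)).
apply filter_imp; intros s [Hfs Hgs]; now split.
Qed.

Lemma continuous_Cmod (z : C) : continuous Cmod z.
Proof. exact (filterlim_norm (V := C_NormedModule) z). Qed.

(** The product topology on complex numbers lets continuity be checked on real and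
    imaginary parts. *)
Lemma continuous_field_of (alpha : R) (uh : C * C) (x : R -> R * R) (lambda : C) :
  0 < Cmod lambda -> continuous x (Cmod lambda) ->
  continuous (fun l => field_of alpha uh l (x (Cmod l))) lambda.
Proof.
intros Hl Hx.
assert (Hx' : continuous (fun l => x (Cmod l)) lambda)
  by (apply continuous_comp; [apply continuous_Cmod | exact Hx]).
assert (H1 : forall v : C, continuous (fun l : C => fst l) v) by (intros []; apply continuous_fst).
assert (H2 : forall v : C, continuous (fun l : C => snd l) v) by (intros []; apply continuous_snd).
assert (X1 : continuous (fun l => fst (x (Cmod l))) lambda).
{ apply (continuous_comp (fun l => x (Cmod l)) fst); [exact Hx' | apply H1]. }
assert (X2 : continuous (fun l => snd (x (Cmod l))) lambda).
{ apply (continuous_comp (fun l => x (Cmod l)) snd); [exact Hx' | apply H2]. }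
assert (Hinv : continuous (fun l => / Cmod l) lambda).
{ apply (continuous_comp Cmod Rinv); [apply continuous_Cmod | apply continuous_Rinv; lra]. }
(* Away from [lambda = 0], each component is a fixed complex number times
   [lambda] times a real factor. *)
assert (Hcomp : forall (c : C) (t : C -> R), continuous t lambda ->
  continuous (fun l : C => ((t l * / Cmod l) * (fst c * fst l - snd c * snd l),
                            (t l * / Cmod l) * (fst c * snd l + snd c * fst l)) : C) lambda).
{ intros c t Ht; apply (continuous_pair (U := R_UniformSpace) (V := R_UniformSpace));
    apply (continuous_mult (K := R_AbsRing)).
  1, 3: now apply (continuous_mult (K := R_AbsRing)).
  1: apply (continuous_minus (V := R_NormedModule)).
  3: apply (continuous_plus (V := R_NormedModule)).
  all: apply (continuous_mult (K := R_AbsRing));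
    (apply continuous_const || apply H1 || apply H2). }
set (ph := cis (- Carg (1 + Ci * alpha)%C)).
apply (continuous_ext_loc _ (fun l : C =>
  (((fst (x (Cmod l)) * / Cmod l) *
     (fst (ph * Csgn (fst uh))%C * fst l - snd (ph * Csgn (fst uh))%C * snd l),
    (fst (x (Cmod l)) * / Cmod l) *
     (fst (ph * Csgn (fst uh))%C * snd l + snd (ph * Csgn (fst uh))%C * fst l)) : C,
   ((snd (x (Cmod l)) * / Cmod l) *
     (fst (ph * Csgn (snd uh))%C * fst l - snd (ph * Csgn (snd uh))%C * snd l),
    (snd (x (Cmod l)) * / Cmod l) *
     (fst (ph * Csgn (snd uh))%C * snd l + snd (ph * Csgn (snd uh))%C * fst l)) : C))).
- assert (Hpos : locally lambda (fun l => 0 < Cmod l)).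
  { apply (continuous_Cmod lambda (fun v => 0 < v)).
    apply (locally_open (fun v => 0 < v)); [apply open_gt | easy | exact Hl]. }
  revert Hpos; apply filter_imp; intros l Hl'.
  assert (HC : RtoC (Cmod l) <> 0) by (intros H; apply RtoC_inj in H; lra).
  unfold field_of, phase; fold ph.
  set (um := fst uh); set (up := snd uh).
  assert (Hre : forall (c : C) (t : R),
    ((t * / Cmod l) * (fst c * fst l - snd c * snd l),
     (t * / Cmod l) * (fst c * snd l + snd c * fst l)) = (RtoC (t / Cmod l) * (c * l))%C).
  { intros [c1 c2] t; destruct l as [l1 l2]; unfold Cmult, RtoC; simpl.
    f_equal; unfold Rdiv; ring. }
  rewrite !Hre, !RtoC_div by lra.
  change ((fst (x (Cmod l)) / Cmod l * (ph * Csgn um * l),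
           snd (x (Cmod l)) / Cmod l * (ph * Csgn up * l))%C =
    ((ph * (l / Cmod l)) * (Csgn um * fst (x (Cmod l))),
     (ph * (l / Cmod l)) * (Csgn up * snd (x (Cmod l))))%C).
  f_equal; field; exact HC.
- now apply (continuous_pair (U := C_UniformSpace) (V := C_UniformSpace)); apply Hcomp.
Qed.

Lemma order0_zero_of (delta mu : R) (uh : C * C) (j : index) :
  order0 delta mu uh j =
  ((Csgn (fst uh) * fst (zero_of delta mu j))%C,
   (Csgn (snd uh) * snd (zero_of delta mu j))%C).
Proof.
destruct uh as [um up].
destruct j as [| [] | []]; unfold order0, mode_vec, zero_of, mode_zero, fst, snd;
  try (match goal with |- scal ?k (?v, ?w) = _ =>
         change (scal k (v, w)) with ((k * v)%C, (k * w)%C) end);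
  try (match goal with |- opp (scal ?k (?v, ?w)) = _ =>
         change (opp (scal k (v, w))) with ((- (k * v))%C, (- (k * w))%C) end);
  rewrite ?RtoC_opp; f_equal; ring.
Qed.

(** [slope_of] is linear in the moduli of the injected field, whereas the
    coefficients of [order1] multiply the components of that field themselves; the
    quotients of moduli in the X and Y modes come from this conversion. *)
Lemma order1_slope_of (delta alpha mu : R) (uh : C * C) (j : index) :
  1 < mu -> fst uh <> 0 -> snd uh <> 0 ->
  let A := Cmod (1 + Ci * alpha) in
  let w := slope_of delta mu (Cmod (fst uh) / A, Cmod (snd uh) / A) j in
  order1 delta alpha mu uh j =
  ((Csgn (fst uh) * fst w)%C, (Csgn (snd uh) * snd w)%C).
Proof.
intros Hmu Hum Hup A w.
destruct uh as [um up]; simpl fst in *; simpl snd in *.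
pose proof (proj1 (Cmod_gt_0 _) (one_plus_Ci_neq0 alpha)) as HA; fold A in HA.
pose proof (proj1 (Cmod_gt_0 um) Hum) as Hm0; pose proof (proj1 (Cmod_gt_0 up) Hup) as Hp0.
pose proof (Csgn_Cmod um Hum) as Hsm; pose proof (Csgn_Cmod up Hup) as Hsp.
assert (Hscal : forall (k t t' : R) (u : C), t = k * t' * Cmod u -> u = (Csgn u * Cmod u)%C ->
  (RtoC k * (RtoC t' * u) = Csgn u * RtoC t)%C).
{ intros k t t' u -> Hu; rewrite !RtoC_mult; rewrite Hu at 1; ring. }
assert (Hpair : forall (k t1 t2 t1' t2' : R),
  t1 = k * t1' * Cmod um -> t2 = k * t2' * Cmod up ->
  (RtoC k * (RtoC t1' * um), RtoC k * (RtoC t2' * up))%C =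
  (Csgn um * RtoC t1, Csgn up * RtoC t2)%C)
  by (intros; f_equal; now apply Hscal).
destruct j as [| [] | []]; unfold order1, mode_w; fold A; unfold w.
{ transitivity (RtoC (-1 / (A * (mu - 1))) * (RtoC 1 * um),
    RtoC (-1 / (A * (mu - 1))) * (RtoC 1 * up))%C; [rewrite !Cmult_1_l; reflexivity |].
  apply Hpair; simpl; field; lra. }
all: rewrite <- ?RtoC_plus, <- ?RtoC_opp; etransitivity; [apply Hpair; reflexivity |];
  simpl; f_equal; do 2 f_equal; field; lra.
Qed.

Lemma little_o_modulus (h : R -> R * R) (u v : C) :
  Cmod u = 1 -> Cmod v = 1 ->
  (forall e, 0 < e -> exists eta, 0 < eta /\
     forall s, 0 < s < eta -> supdist (h s) (0, 0) <= e * s) ->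
  little_o (fun l => ((u * fst (h (Cmod l)))%C, (v * snd (h (Cmod l)))%C)).
Proof.
intros Hu Hv Hh; apply filterlim_locally; intros e.
assert (He : 0 < e / 3) by (pose proof (cond_pos e); lra).
destruct (Hh _ He) as (eta & Heta & Hs).
assert (Hnear : locally (RtoC 0) (fun l => Cmod l < eta)).
{ apply (continuous_Cmod 0 (fun r => r < eta)).
  apply (locally_open (fun r => r < eta)); [apply open_lt | easy |].
  now rewrite Cmod_0. }
unfold locally', within; revert Hnear; apply filter_imp; intros l Hl Hl0.
pose proof (proj1 (Cmod_gt_0 l) Hl0) as Hpos.
specialize (Hs (Cmod l) (conj Hpos Hl)).
pose proof (fst_le_supdist (h (Cmod l)) (0, 0)) as H1.
pose proof (snd_le_supdist (h (Cmod l)) (0, 0)) as H2.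
simpl in H1, H2; rewrite Rminus_0_r in H1, H2.
set (N := norm2 _).
assert (HN : 0 <= N <= 2 * (e / 3) * Cmod l).
{ unfold N; rewrite norm2E; simpl fst; simpl snd.
  rewrite !Cmod_mult, !Cmod_R, Hu, Hv, !Rmult_1_l.
  pose proof (Rabs_pos (fst (h (Cmod l)))); pose proof (Rabs_pos (snd (h (Cmod l)))).
  split; [apply sqrt_pos |].
  apply Rle_trans with (sqrt ((Rabs (fst (h (Cmod l))) + Rabs (snd (h (Cmod l)))) ^ 2)).
  - apply sqrt_le_1_alt; nra.
  - rewrite sqrt_pow2; lra. }
assert (Hq : 0 <= N / Cmod l < e).
{ split; [apply Rdiv_le_0_compat; lra |].
  apply Rlt_div_l; [exact Hpos | nra]. }
change (Rabs (N / Cmod l - 0) < e); rewrite Rabs_pos_eq; lra.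
Qed.

Lemma field_of_inj (alpha : R) (uh : C * C) (lambda : C) (x x' : R * R) :
  fst uh <> 0 -> snd uh <> 0 -> lambda <> 0 ->
  field_of alpha uh lambda x = field_of alpha uh lambda x' -> x = x'.
Proof.
intros Hum Hup Hl H.
assert (Hcancel : forall (u : C) (t t' : R), u <> 0 ->
  (phase alpha lambda * (Csgn u * t) = phase alpha lambda * (Csgn u * t'))%C -> t = t').
{ intros u t t' Hu Ht.
  assert (H0 : (phase alpha lambda * (Csgn u * RtoC (t - t')) = 0)%C).
  { rewrite RtoC_minus.
    transitivity (phase alpha lambda * (Csgn u * t) - phase alpha lambda * (Csgn u * t'))%C;
      [ring | rewrite Ht; ring]. }
  apply (f_equal Cmod) in H0.
  rewrite !Cmod_mult, Cmod_phase, Cmod_Csgn, Cmod_R, Cmod_0 in H0 by assumption.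
  rewrite !Rmult_1_l in H0; apply Rminus_diag_uniq; revert H0.
  unfold Rabs; destruct Rcase_abs; lra. }
destruct x as [x1 x2], x' as [x1' x2']; f_equal.
- apply (Hcancel (fst uh)); [exact Hum | exact (f_equal fst H)].
- apply (Hcancel (snd uh)); [exact Hup | exact (f_equal snd H)].
Qed.

Lemma diagonal_field (alpha : R) (uh : C * C) (lambda : C) (x : R * R) :
  fst uh <> 0 -> snd uh <> 0 -> Cmod (fst uh) = Cmod (snd uh) -> fst x = snd x ->
  exists rho : C, field_of alpha uh lambda x = scal rho uh.
Proof.
intros Hum Hup Heq Hx.
destruct uh as [um up], x as [x1 x2]; simpl in *; subst x2.
pose proof (proj1 (Cmod_gt_0 up) Hup) as Hpos.
exists (phase alpha lambda * (x1 / Cmod up))%C.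
unfold field_of, Csgn; simpl fst; simpl snd; rewrite Heq.
change (((phase alpha lambda * (um / Cmod up * x1))%C,
         (phase alpha lambda * (up / Cmod up * x1))%C) =
  ((phase alpha lambda * (x1 / Cmod up) * um)%C,
   (phase alpha lambda * (x1 / Cmod up) * up)%C)).
assert (HC : RtoC (Cmod up) <> 0) by (intros H; apply RtoC_inj in H; lra).
f_equal; field; exact HC.
Qed.

Lemma is_branch_unique (f g : R * R -> R) (p z w : R * R) (r ell s : R)
    (br : R -> R * R) (x : R * R) :
  is_branch f g p z w r ell br -> 0 <= s < ell ->
  supdist x z <= r -> f x = s * fst p -> g x = s * snd p -> x = br s.
Proof.
intros (Hbr & (K & HK & Hlip) & _) Hs Hx H1 H2.
destruct (Hbr s Hs) as (B0 & B1 & B2).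
apply supdist_eq0; specialize (Hlip x (br s) Hx B0).
rewrite H1, H2, B1, B2, supdist_refl in Hlip; lra.
Qed.

(** With equal right-hand sides the equations are invariant under [swap], which maps
    the branch near a symmetric zero to itself by uniqueness. *)
Lemma symmetric_branch (delta mu a : R) (z w : R * R) (r ell s : R) (br : R -> R * R) :
  is_branch (balance_minus delta mu) (balance_plus delta mu) (a, a) z w r ell br ->
  swap z = z -> 0 <= s < ell -> fst (br s) = snd (br s).
Proof.
intros Hbr Hz Hs.
pose proof Hbr as (H & _ & _); destruct (H s Hs) as (B0 & B1 & B2).
assert (Hswap : swap (br s) = br s).
{ apply (is_branch_unique _ _ _ _ _ _ _ _ _ _ Hbr Hs).
  - rewrite <- Hz; unfold supdist, swap; simpl; now rewrite Rmax_comm.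
  - exact B2.
  - unfold balance_plus, swap; simpl; rewrite <- surjective_pairing; exact B1. }
now rewrite <- Hswap at 1.
Qed.

Theorem theorem2 (kappa gamma delta alpha mu : R)
  (hkappa : 0 < kappa) (hgamma : 0 < gamma) (hdelta : 0 < delta) (hmu : 1 < mu)
  (uh : C * C) (hum : fst uh <> RtoC 0) (hup : snd uh <> RtoC 0) :
  exists (ell : R) (Ej : index -> C -> C * C),
    0 < ell /\
    (forall (j : index) (lambda : C), 0 < Cmod lambda < ell ->
       continuous (Ej j) lambda) /\
    (forall (j k : index) (lambda : C), 0 < Cmod lambda < ell ->
       j <> k -> Ej j lambda <> Ej k lambda) /\
    (forall lambda : C, 0 < Cmod lambda < ell ->
       forall (E : C * C) (N n : R),
         is_equilibrium kappa gamma delta alpha mu (scal lambda uh) E N n <->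
         (exists j : index, E = Ej j lambda) /\
         (N, n) = y delta mu (Cmod (fst E), Cmod (snd E))) /\
    (let theta := - Carg (1 + Ci * alpha)%C in
     forall j : index, exists g : C -> C * C,
       little_o g /\
       forall lambda : C, 0 < Cmod lambda < ell ->
         Ej j lambda =
         scal (cis theta * (lambda / Cmod lambda))%C
           (plus (plus (order0 delta mu uh j)
                    (scal (RtoC (Cmod lambda)) (order1 delta alpha mu uh j)))
              (g lambda))) /\
    (Cmod (fst uh) = Cmod (snd uh) ->
     forall j : index, j = JZero \/ j = JPos ModeX \/ j = JNeg ModeX ->
       forall lambda : C, 0 < Cmod lambda < ell ->
         exists rho : C, Ej j lambda = scal rho uh).
Proof.
set (A := Cmod (1 + Ci * alpha)).
set (p := (Cmod (fst uh) / A, Cmod (snd uh) / A)).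
assert (Hcont : forall x, continuous (balance_minus delta mu) x)
  by (intros x; eapply strict_diff_continuous, strict_diff_balance_minus, hdelta).
assert (Hcont' : forall x, continuous (balance_plus delta mu) x)
  by (intros x; eapply strict_diff_continuous, strict_diff_balance_plus,
        strict_diff_balance_minus, hdelta).
destruct (perturbed_zeros (balance_minus delta mu) (balance_plus delta mu) p
  (zero_of delta mu) (slope_of delta mu p) (1 + mu))
  as (r & ell & br & Hell & Hbr & Hnear & Hsep).
{ exact Hcont. }
{ exact Hcont'. }
{ intros x; now apply balance_zeros. }
{ intros x H1 H2; apply supdist_le; simpl; rewrite !Rminus_0_r.
  split; [apply (balance_coercive delta mu x) | apply (balance_coercive delta mu (swap x))];
    (lra || assumption). }
{ intros j k; now apply zero_of_inj. }
{ intros j; now apply regular_zero_of. }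
assert (Hneq0 : forall l : C, 0 < Cmod l < ell -> l <> 0)
  by (intros l Hl; apply Cmod_gt_0; lra).
exists ell, (fun j l => field_of alpha uh l (br j (Cmod l))); split; [exact Hell |].
split; [| split; [| split; [| split]]].
- intros j l Hl; apply continuous_field_of; [lra |].
  eapply is_branch_continuous; [apply Hbr | exact Hl].
- intros j k l Hl Hjk H; apply Hjk.
  apply field_of_inj in H; [| assumption | assumption | now apply Hneq0].
  destruct (Hbr j) as (Hj & _), (Hbr k) as (Hk & _).
  apply (Hsep j k (br j (Cmod l))); [| rewrite H]; [apply Hj | apply Hk]; lra.
- intros l Hl E N n.
  rewrite equilibrium_balance by (try assumption; now apply Hneq0).
  fold A; change (Cmod (fst uh) / A) with (fst p); change (Cmod (snd uh) / A) with (snd p).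
  split; intros [HE Hy]; (split; [| exact Hy]).
  + destruct HE as (x & -> & H1 & H2).
    destruct (Hnear (Cmod l) x ltac:(lra) H1 H2) as [j Hj]; exists j.
    f_equal; apply (is_branch_unique _ _ _ _ _ _ _ _ _ _ (Hbr j)); (lra || assumption).
  + destruct HE as [j ->]; exists (br j (Cmod l)); split; [reflexivity |].
    destruct (Hbr j) as (Hj & _); apply Hj; lra.
- intros theta j.
  pose (z := zero_of delta mu j); pose (w := slope_of delta mu p j).
  pose (h s := (fst (br j s) - (fst z + s * fst w), snd (br j s) - (snd z + s * snd w))).
  exists (fun l => ((Csgn (fst uh) * fst (h (Cmod l)))%C, (Csgn (snd uh) * snd (h (Cmod l)))%C)).
  split.
  + apply little_o_modulus; [now apply Cmod_Csgn | now apply Cmod_Csgn |].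
    intros e He; destruct (Hbr j) as (_ & _ & Hj).
    destruct (Hj e He) as (eta & Heta & H).
    exists (Rmin eta ell); split; [now apply Rmin_pos |].
    intros s Hs; pose proof (Rmin_l eta ell); pose proof (Rmin_r eta ell).
    specialize (H s ltac:(lra) ltac:(lra)).
    unfold supdist in *; simpl in *; now rewrite !Rminus_0_r.
  + intros l Hl.
    rewrite order0_zero_of, order1_slope_of by assumption.
    fold A; fold p; fold z; fold w; unfold field_of; fold theta.
    change (cis theta * (l / Cmod l))%C with (phase alpha l).
    f_equal; unfold h; simpl fst; simpl snd.
    match goal with |- _ = plus (plus (?a, ?b) (scal ?k (?a', ?b'))) (?c, ?d) =>
      change (plus (plus (a, b) (scal k (a', b'))) (c, d))
        with ((a + k * a' + c)%C, (b + k * b' + d)%C) end.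
    rewrite !RtoC_minus, !RtoC_plus, !RtoC_mult; f_equal; ring.
- intros Heq j Hj l Hl; apply diagonal_field; try assumption.
  assert (Hp : p = (Cmod (fst uh) / A, Cmod (fst uh) / A)) by (unfold p; now rewrite Heq).
  pose proof (Hbr j) as Hb; rewrite Hp in Hb.
  apply (symmetric_branch _ _ _ _ _ _ _ _ _ Hb); [| lra].
  now destruct Hj as [-> | [-> | ->]].
Qed.
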